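(* Let $(X,\mathscr B,m)$ be a probability space and let $P:L^1(m)\to L^1(m)$ be a Markov operator. If $P$ satisfies (AMC2), then $P$ satisfies (FED). In particular, if $P$ satisfies (AC), then $P$ satisfies (MC).
   Context: $D(m)=\{h\in L^1(m):h\ge0\ m\text{-a.e.},\ \|h\|=1\}$. A Markov operator on $L^1(m)$ is a linear positive operator $P$ with $\int P\varphi\,dm=\int\varphi\,dm$ for all $\varphi\in L^1(m)$. $P^*$ is its adjoint on $L^\infty(m)$ and $P^{n*}=(P^* )^n$. $A_n=\frac1n\sum_{i=0}^{n-1}P^i$. (AMC2): there exist $\kappa<1$ and $\delta>0$ such that $\limsup_{n\to\infty}\int_EA_n\varphi\,dm<\kappa$ for any $\varphi\in D(m)$ and $E\in\mathscr B$ with $m(E)<\delta$. (AC) (asymptotically constrictive): for any $\varepsilon>0$ there is $\delta>0$ such that $\limsup_{n\to\infty}\int_EP^n\varphi\,dm<\varepsilon$ for any $\varphi\in D(m)$ and $E\in\mathscr B$ with $m(E)<\delta$. (MC) (mean constrictive): there is a compact set $F\subset L^1(m)$ with $\lim_{n\to\infty}\inf_{\psi\in F}\|A_nh-\psi\|=0$ for every $h\in D(m)$. (FED): $P$ admits finitely many ergodic invariant densities $h_1,\dots,h_r$ with mutually disjoint supports (up to an $m$-null set), and $h=\frac1r(h_1+\dots+h_r)$ has the maximal support. Here $\operatorname{supp}h=\{h\ne0\}$. An invariant density is $h\in D(m)$ with $Ph=h$. It has the maximal support if $\lim_{n\to\infty}P^{n*}1_{\operatorname{supp}h}=1$ $m$-a.e.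 It is ergodic if $\int_Ah\,dm\in\{0,1\}$ for every $A\in\mathscr B$ with $P^*1_A\ge1_A$ ($m$-a.e.). *)

(* Defs.v *)
From HB Require Import structures.
From mathcomp Require Import all_boot all_order all_algebra.
From mathcomp Require Import all_classical all_reals all_analysis.
From mathcomp Require Import ess_sup_inf measurable_realfun.

Set Implicit Arguments.
Unset Strict Implicit.
Unset Printing Implicit Defensive.

Import Order.TTheory GRing.Theory Num.Theory.
Import numFieldNormedType.Exports.

Local Open Scope classical_set_scope.
Local Open Scope ring_scope.
Local Open Scope quotient_scope.

Lemma eq_ae_Lnorm d (T : measurableType d) (R : realType)
    (mu : {measure set T -> \bar R}) (p : \bar R) (f g : T -> R) :
  measurable_fun setT f -> measurable_fun setT g ->
  {ae mu, forall x, f x = g x} ->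
  ('N[mu]_p[EFin \o f] = 'N[mu]_p[EFin \o g])%E.
Proof.
have mabs (h : T -> R) r : measurable_fun setT h ->
    measurable_fun setT (fun x => `|(EFin \o h) x| `^ r)%E.
  move=> mh; apply/measurable_EFinP.
  apply: (measurableT_comp (measurable_powR _)).
  exact: measurableT_comp.
move=> mf mg fg; rewrite Lnorm.unlock; case: p => [r| |].
- have -> : (\int[mu]_x (`|(EFin \o f) x| `^ r) =
              \int[mu]_x (`|(EFin \o g) x| `^ r))%E; last by [].
  apply: ae_eq_integral.
  + exact: measurableT.
  + exact: mabs.
  + exact: mabs.
  + by apply: filterS fg => x /= -> _.
- case: ifPn => // _; apply: eq_ess_sup.
  by apply: filterS fg => x /= ->.
- case: ifPn => // _; apply: eq_ess_inf.
  by apply: filterS fg => x /= ->.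
Qed.

Section null_functions.
Context d (T : measurableType d) (R : realType).
Context (mu : {measure set T -> \bar R}) (p : \bar R) (p1 : (1 <= p)%E).

Definition Lfun_null : {pred LfunType mu p1} :=
  [pred f : LfunType mu p1 | `[< {ae mu, forall x, f x = 0} >]].

Lemma Lfun_nullP (f : LfunType mu p1) :
  reflect {ae mu, forall x, f x = 0} (f \in Lfun_null).
Proof. by rewrite inE /=; exact: asboolP. Qed.

Lemma Lfun_null_zmod_closed : zmod_closed Lfun_null.
Proof.
split; first by apply/Lfun_nullP; exact: aeW.
move=> f g /Lfun_nullP f0 /Lfun_nullP g0; apply/Lfun_nullP.
apply: filterS2 f0 g0 => x fx gx.
by rewrite [LHS](_ : _ = f x - g x)// fx gx subr0.
Qed.

HB.instance Definition _ :=
  GRing.isZmodClosed.Build (LfunType mu p1) Lfun_null Lfun_null_zmod_closed.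

End null_functions.

(* The library's LspaceType carries neither algebraic nor normed structure, so
   L^p is taken here as the quotient of the module LfunType of p-integrable
   functions by the null functions, with the p-norm. *)
Section Lebesgue_space.
Context d (T : measurableType d) (R : realType).
Context (mu : {measure set T -> \bar R}) (p : \bar R) (p1 : (1 <= p)%E).

Definition Lp : Type := Quotient.quot (@Lfun_null _ _ _ mu p p1).

HB.instance Definition _ := Choice.on Lp.
HB.instance Definition _ := EqQuotient.on Lp.
HB.instance Definition _ := GRing.Zmodule.on Lp.
HB.instance Definition _ := ZmodQuotient.on Lp.

Definition Lp_fun (f : Lp) : T -> R := repr f.

(* The value is 0 when f is not in Lfun mu p. *)
Definition Lp_class (f : T -> R) : Lp := \pi_Lp (insubd 0 f).

Lemma piLpP (f g : LfunType mu p1) :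
  \pi_Lp f = \pi_Lp g <-> {ae mu, forall x, f x = g x}.
Proof.
split.
  move=> /eqP; rewrite -Quotient.idealrBE => /Lfun_nullP.
  by apply: filterS => x fg0; apply/eqP; rewrite -subr_eq0; exact/eqP.
move=> fg; apply/eqP; rewrite -Quotient.idealrBE; apply/Lfun_nullP.
apply: filterS fg => x fg.
by rewrite [LHS](_ : _ = f x - g x)// fg subrr.
Qed.

Lemma LpP (f g : Lp) : f = g <-> {ae mu, forall x, Lp_fun f x = Lp_fun g x}.
Proof. by rewrite -piLpP !reprK. Qed.

Lemma Lp_fun_pi (f : LfunType mu p1) :
  {ae mu, forall x, Lp_fun (\pi_Lp f) x = f x}.
Proof. by apply/piLpP; rewrite reprK. Qed.

Lemma Lp_classK (f : T -> R) : f \in Lfun mu p ->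
  {ae mu, forall x, Lp_fun (Lp_class f) x = f x}.
Proof.
move=> fL; have := Lp_fun_pi (insubd 0 f).
by apply: filterS => x; rewrite /Lp_class => ->; rewrite insubdK.
Qed.

Lemma Lp_fun0 : {ae mu, forall x, Lp_fun 0 x = 0}.
Proof. by have := Lp_fun_pi 0; rewrite pi_zeror. Qed.

Lemma Lp_funD (f g : Lp) :
  {ae mu, forall x, Lp_fun (f + g) x = Lp_fun f x + Lp_fun g x}.
Proof. by have := Lp_fun_pi (repr f + repr g); rewrite pi_addr !reprK. Qed.

Definition Lp_scale (a : R) (f : Lp) : Lp := \pi_Lp (a *: repr f).

Lemma Lp_fun_scale a (f : Lp) :
  {ae mu, forall x, Lp_fun (Lp_scale a f) x = a * Lp_fun f x}.
Proof. exact: Lp_fun_pi. Qed.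

Let scaleA a b v : Lp_scale a (Lp_scale b v) = Lp_scale (a * b) v.
Proof.
apply/LpP; apply: filterS3 (Lp_fun_scale a (Lp_scale b v))
  (Lp_fun_scale b v) (Lp_fun_scale (a * b) v) => x -> -> ->.
by rewrite mulrA.
Qed.

Let scale1 : left_id 1 Lp_scale.
Proof.
by move=> v; apply/LpP; apply: filterS (Lp_fun_scale 1 v) => x ->; rewrite mul1r.
Qed.

Let scaleDr : right_distributive Lp_scale +%R.
Proof.
move=> a u v; rewrite -[u]reprK -[v]reprK -pi_addr.
apply/LpP; near=> x.
rewrite (near (Lp_fun_scale _ _) x)// (near (Lp_funD (Lp_scale _ _) _) x)//.
rewrite !(near (Lp_fun_scale _ _) x)// !(near (Lp_fun_pi _) x)//.
by rewrite /= mulrDr.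
Unshelve. all: by end_near. Qed.

Let scaleDl v : {morph Lp_scale^~ v : a b / a + b}.
Proof.
move=> a b; apply/LpP; near=> x.
rewrite (near (Lp_fun_scale _ _) x)// (near (Lp_funD (Lp_scale _ _) _) x)//.
by rewrite !(near (Lp_fun_scale _ _) x)// mulrDl.
Unshelve. all: by end_near. Qed.

HB.instance Definition _ := GRing.Zmodule_isLmodule.Build R Lp
  scaleA scale1 scaleDr scaleDl.

Lemma Lp_funZ a (f : Lp) :
  {ae mu, forall x, Lp_fun (a *: f) x = a * Lp_fun f x}.
Proof. exact: Lp_fun_scale. Qed.

Definition Lp_norm (f : Lp) : R := fine ('N[mu]_p[EFin \o Lp_fun f])%E.

Lemma Lp_norm_pi (f : LfunType mu p1) :
  Lp_norm (\pi_Lp f) = fine ('N[mu]_p[EFin \o f])%E.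
Proof. by rewrite /Lp_norm (eq_ae_Lnorm _ _ _ (Lp_fun_pi f)). Qed.

Lemma ler_Lp_normD (f g : Lp) : Lp_norm (f + g) <= Lp_norm f + Lp_norm g.
Proof.
by rewrite -{1}[f]reprK -{1}[g]reprK -pi_addr Lp_norm_pi; exact: ler_LnormD.
Qed.

Lemma Lp_normZ (a : R) (f : Lp) : Lp_norm (a *: f) = `|a| * Lp_norm f.
Proof.
rewrite Lp_norm_pi; apply: EFin_inj.
by rewrite EFinM !finite_norm_fine; exact: LnormZ.
Qed.

Lemma Lp_norm_eq0 (f : Lp) : Lp_norm f = 0 -> f = 0.
Proof.
move=> /fine_Lnormr_eq0 f0; apply/LpP; apply: filterS2 f0 Lp_fun0 => x f0 ->.
exact: f0.
Qed.

HB.instance Definition _ :=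
  Lmodule_isNormed.Build R Lp ler_Lp_normD Lp_normZ Lp_norm_eq0.

End Lebesgue_space.
Arguments Lp {d T R} mu {p} p1.
Arguments Lp_class {d T R mu p} p1 f.

Coercion Lp_fun : Lp >-> Funclass.

Notation L1 m := (Lp m (@lexx _ _ 1%E)).
Notation Linf m := (Lp m (leey 1%E)).

Lemma L1_normE d (T : measurableType d) (R : realType)
  (m : probability T R) (f : L1 m) : `|f| = \int[m]_x `|f x|.
Proof. by rewrite [LHS](_ : _ = Lp_norm f)// /Lp_norm Lnorm1. Qed.

Section Markov_operators.
Context d (T : measurableType d) (R : realType) (m : probability T R).
Implicit Types (P : L1 m -> L1 m) (f h phi : L1 m) (g : Linf m).

Definition densities : set (L1 m) :=
  [set h : L1 m | {ae m, forall x, 0 <= h x} /\ `|h| = 1].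

Definition Markov P : Prop :=
  [/\ linear P,
      forall f, {ae m, forall x, 0 <= f x} -> {ae m, forall x, 0 <= P f x} &
      forall f, \int[m]_x P f x = \int[m]_x f x].

Definition cesaro_mean P (n : nat) f : L1 m := n%:R^-1 *: \sum_(i < n) iter i P f.

Definition AMC2 P : Prop := exists kappa delta : R,
  [/\ kappa < 1, 0 < delta &
      forall phi (E : set T), densities phi ->
        measurable E -> (m E < delta%:E)%E ->
        (limn_esup (fun n => \int[m]_(x in E) (cesaro_mean P n phi x)%:E)
           < kappa%:E)%E].

Definition asymptotically_constrictive P : Prop := forall eps : R, 0 < eps ->
  exists2 delta : R, 0 < delta &
    forall phi (E : set T), densities phi ->
      measurable E -> (m E < delta%:E)%E ->
      (limn_esup (fun n => \int[m]_(x in E) (iter n P phi x)%:E) < eps%:E)%E.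

(* The infimum is taken in \bar R so that it is +oo when F is empty. *)
Definition mean_constrictive P : Prop := exists2 F : set (L1 m), compact F &
  forall h, densities h ->
    ereal_inf [set (`|cesaro_mean P n h - psi|)%:E | psi in F] @[n --> \oo] --> 0%E.

(* For P bounded on L^1, in particular for a Markov P, exactly one k satisfies
   the condition, since L^infty is the dual of L^1. *)
Definition adjoint P g : Linf m :=
  get [set k : Linf m | forall f,
    \int[m]_x (P f x * g x) = \int[m]_x (f x * k x)].

Definition indic_class (A : set T) : Linf m := Lp_class (leey 1%E) \1_A.

Lemma indic_classE (A : set T) : measurable A ->
  {ae m, forall x, indic_class A x = \1_A x}.
Proof.
move=> mA; apply: Lp_classK; rewrite inE; apply/andP; split; rewrite inE /=.
  exact: measurable_indic.
rewrite /finite_norm Lnorm.unlock /Lnorm; case: ifPn => // _.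
rewrite (@le_lt_trans _ _ 1%E) ?ltry//; apply/ess_supP; apply: aeW => x /=.
by rewrite lee_fin indicE; case: (_ \in _); rewrite ?normr1 ?normr0.
Qed.

Definition supp h : set T := [set x | h x != 0].

Lemma measurable_supp h : measurable (supp h).
Proof.
have -> : supp h = h @^-1` (~` [set 0]).
  by apply/seteqP; split => x /= /eqP.
rewrite -[X in measurable X]setTI; apply: (measurable_funPT h) => //.
exact/measurableC.
Qed.

Definition invariant_density P h : Prop := densities h /\ P h = h.

Definition maximal_support P h : Prop :=
  {ae m, forall x,
    (iter n (adjoint P) (indic_class (supp h)) : T -> R) x @[n --> \oo]
      --> (1 : R)}.

Definition ergodic P h : Prop := forall A : set T, measurable A ->
  {ae m, forall x, \1_A x <= adjoint P (indic_class A) x} ->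
  \int[m]_(x in A) h x = 0 \/ \int[m]_(x in A) h x = 1.

Definition FED P : Prop := exists (r : nat) (h : 'I_r -> L1 m),
  [/\ (0 < r)%N,
      forall i, invariant_density P (h i) /\ ergodic P (h i),
      forall i j, i != j -> m (supp (h i) `&` supp (h j)) = 0%E &
      maximal_support P (r%:R^-1 *: \sum_(i < r) h i)].

End Markov_operators.

(* Main.v *)
Require Import Defs.
From HB Require Import structures.
From mathcomp Require Import all_boot all_order all_algebra.
From mathcomp Require Import all_classical all_reals all_analysis.
From mathcomp Require Import ess_sup_inf measurable_realfun.
From mathcomp Require Import ring lra.

Set Implicit Arguments.
Unset Strict Implicit.
Unset Printing Implicit Defensive.

Import Order.TTheory GRing.Theory Num.Theory.
Import numFieldNormedType.Exports.

Local Open Scope classical_set_scope.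
Local Open Scope ring_scope.

(**
The first claim rests on one fact about a single density phi: under the smallness
condition with constants kappa < 1 and delta, there is an invariant function
f >= 0 of mass at least 1 - kappa which lies, up to arbitrarily small errors,
below densities with the same asymptotic Cesaro means as phi ([invariant_below]). A gliding hump argument
([eventually_uniform]) turns smallness on each fixed small set into a uniform
statement: at some level K, all late Cesaro means lose at most the mass kappa
when truncated at K. The functions that lie between 0 and K and below an almost
invariant density with the same asymptotic Cesaro means as phi, and that have
mass at least 1 - kappa, form nested convex sets which are bounded in L2, so
near-minimizers of the L2 norm converge in L1 ([convex_selection]). The limit g
is below such densities up to arbitrarily small errors, and so are P g and the
maximum of g and P g; iterating f |-> max f (P f) from g yields an increasing
sequence of integral at most 1, whose limit f satisfies P f <= f, and hence
P f = f ([below_means_invariant]).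

An invariant density equals its own Cesaro means, so its support has measure at
least delta; therefore families of invariant densities with disjoint supports
have bounded length, and one takes h_1, ..., h_r of maximal length. Maximality
gives the rest: a set A with P^* 1_A >= 1_A cuts h_i into two invariant pieces,
so one of them is 0 and h_i is ergodic ([maximal_ergodic]); an invariant function
has no mass outside the union S of the supports ([invariant_supported]); and,
applied to the positive and negative parts of a difference, an invariant function
on the support of h_i is a multiple of h_i ([restr_family]). For the maximality of
the support, [invariant_below] shows that any density eventually has at most
about kappa of its mass outside S. Mass that has entered S stays there, so
restarting from the part still outside gains a factor less than 1 each time, and
the mass outside S tends to 0 ([outside_cvg0]). For the density 1 this says that
the increasing functions P^{n*} 1_S have integrals tending to 1, whence the
convergence almost everywhere. The adjoint exists because bounded functionals on
L1 are given by bounded functions ([L1_dual], from the Radon-Nikodym theorem).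

For the second claim, asymptotic constrictiveness gives the smallness condition
for every kappa > 0. Then f above has mass almost 1 and lies essentially below a
density F with the same asymptotic Cesaro means as phi, so f and F are close in
norm; averaging does not increase distances and fixes f, so the Cesaro means of
phi come close to f ([cesaro_near_invariant]). By the first part f is a
combination of h_1, ..., h_r with coefficients in [0, 1], and these combinations
form a compact set.
*)

(** * The vector lattice L1 *)

Section L1_lattice.
Context d (T : measurableType d) (R : realType) (m : probability T R).
Implicit Types (f g h : L1 m) (A : set T) (u v : T -> R).

Lemma L1_integrable f : m.-integrable setT (EFin \o (f : T -> R)).
Proof. exact/Lfun1_integrable/(LfunP (repr f)). Qed.

Lemma L1_measurable f : measurable_fun setT (f : T -> R).
Proof. by have /measurable_int/measurable_EFinP := L1_integrable f. Qed.

Lemma ae_Rintegral u v : measurable_fun setT u -> measurable_fun setT v ->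
  {ae m, forall x, u x = v x} -> \int[m]_x u x = \int[m]_x v x.
Proof.
move=> mu mv uv; congr fine; apply: ae_eq_integral => //.
- exact/measurable_EFinP.
- exact/measurable_EFinP.
- by apply: filterS uv => x /= -> _.
Qed.

Lemma ae_integrable u v : measurable_fun setT u -> {ae m, forall x, `|u x| <= v x} ->
  m.-integrable setT (EFin \o v) -> m.-integrable setT (EFin \o u).
Proof.
move=> mu uv /integrableP[mv iv]; apply/integrableP; split.
  exact/measurable_EFinP.
apply: le_lt_trans iv; apply: ae_ge0_le_integral => //.
- exact/measurableT_comp/measurable_EFinP.
- exact: measurableT_comp.
- apply: filterS uv => x /= uv _; rewrite lee_fin (le_trans uv)//.
  exact: ler_norm.
Qed.

Definition toL1 u : L1 m := Lp_class (@lexx _ _ 1%E) u.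

Lemma toL1E u : m.-integrable setT (EFin \o u) -> {ae m, forall x, toL1 u x = u x}.
Proof. by move=> iu; apply: Lp_classK; exact/Lfun1_integrable. Qed.

Definition intL f : R := \int[m]_x f x.

Lemma int_toL1 u : m.-integrable setT (EFin \o u) -> intL (toL1 u) = \int[m]_x u x.
Proof.
move=> iu; apply: ae_Rintegral; [exact: L1_measurable| |exact: toL1E].
by have /measurable_int/measurable_EFinP := iu.
Qed.

Lemma L1P f g : {ae m, forall x, f x = g x} -> f = g.
Proof. by move=> ?; exact/LpP. Qed.

Lemma L1_fun0 : {ae m, forall x, Lp_fun (0 : L1 m) x = 0}.
Proof. exact: Lp_fun0. Qed.

Lemma L1_funN f : {ae m, forall x, Lp_fun (- f) x = - f x}.
Proof. by rewrite -scaleN1r; apply: filterS (Lp_funZ (-1) f) => x ->; rewrite mulN1r. Qed.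

Lemma L1_funB f g : {ae m, forall x, Lp_fun (f - g) x = f x - g x}.
Proof. by apply: filterS2 (Lp_funD f (- g)) (L1_funN g) => x -> ->. Qed.

Lemma L1_fun_sum (I : Type) (s : seq I) (F : I -> L1 m) (u : I -> T -> R) :
  (forall i, {ae m, forall x, F i x = u i x}) ->
  {ae m, forall x, Lp_fun (\sum_(i <- s) F i) x = \sum_(i <- s) u i x}.
Proof.
move=> Fu; elim: s => [|i s ih].
  by apply: filterS L1_fun0 => x; rewrite !big_nil.
apply: filterS3 (Fu i) ih (Lp_funD (F i) (\sum_(j <- s) F j)) => x.
by rewrite !big_cons => -> -> ->.
Qed.

Lemma intD f g : intL (f + g) = intL f + intL g.
Proof.
rewrite /intL -RintegralD//; [|exact: L1_integrable..].
apply: ae_Rintegral (Lp_funD f g); first exact: L1_measurable.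
by apply: measurable_funD; exact: L1_measurable.
Qed.

Lemma intZ a f : intL (a *: f) = a * intL f.
Proof.
rewrite /intL -RintegralZl//; [|exact: L1_integrable..].
apply: ae_Rintegral (Lp_funZ a f); first exact: L1_measurable.
by apply: measurable_funM => //; exact: L1_measurable.
Qed.

Lemma intN f : intL (- f) = - intL f.
Proof. by rewrite -scaleN1r intZ mulN1r. Qed.

Lemma intB f g : intL (f - g) = intL f - intL g.
Proof. by rewrite intD intN. Qed.

Lemma int0 : intL 0 = 0.
Proof. by rewrite -(scale0r (0 : L1 m)) intZ mul0r. Qed.

Lemma int_sum (I : Type) (s : seq I) (F : I -> L1 m) :
  intL (\sum_(i <- s) F i) = \sum_(i <- s) intL (F i).
Proof.
by elim: s => [|i s ih]; rewrite ?big_nil ?int0// !big_cons intD ih.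
Qed.

Definition leL f g : Prop := {ae m, forall x, f x <= g x}.
Local Notation "f [<=] g" := (leL f g) (at level 70).

Lemma leL_refl f : f [<=] f.
Proof. exact: aeW. Qed.

Lemma leL_trans g f h : f [<=] g -> g [<=] h -> f [<=] h.
Proof. by apply: filterS2 => x; exact: le_trans. Qed.

Lemma leL_anti f g : f [<=] g -> g [<=] f -> f = g.
Proof. by move=> fg gf; apply: L1P; apply: filterS2 fg gf => x a b; apply/eqP; rewrite eq_le a b. Qed.

Lemma ge0LP f : 0 [<=] f <-> {ae m, forall x, 0 <= f x}.
Proof.
by split; apply: filterS2 L1_fun0 => x ->.
Qed.

Lemma subL_ge0 f g : 0 [<=] g - f <-> f [<=] g.
Proof.
rewrite ge0LP; split; apply: filterS2 (L1_funB g f) => x ->; by rewrite subr_ge0.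
Qed.

Lemma subL_le0 f g : f - g [<=] 0 <-> f [<=] g.
Proof.
split=> fg; near=> x.
  rewrite -subr_le0 -(near (L1_funB f g) x)// -[leRHS](near L1_fun0 x)//.
  by near: x.
by rewrite (near (L1_funB f g) x)// (near L1_fun0 x)// subr_le0; near: x.
Unshelve. all: by end_near. Qed.

Lemma leLD f g f' g' : f [<=] g -> f' [<=] g' -> f + f' [<=] g + g'.
Proof.
move=> fg fg'; near=> x.
rewrite (near (Lp_funD f f') x)// (near (Lp_funD g g') x)// lerD//; by near: x.
Unshelve. all: by end_near. Qed.

Lemma leLZ a f g : 0 <= a -> f [<=] g -> a *: f [<=] a *: g.
Proof.
move=> a0 fg; near=> x.
rewrite (near (Lp_funZ a f) x)// (near (Lp_funZ a g) x)// ler_wpM2l//; by near: x.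
Unshelve. all: by end_near. Qed.

Lemma geL0Z a f : 0 <= a -> 0 [<=] f -> 0 [<=] a *: f.
Proof. by move=> a0 /(leLZ a0); rewrite scaler0. Qed.

Lemma sumL_ge0 (I : Type) (s : seq I) (F : I -> L1 m) :
  (forall i, 0 [<=] F i) -> 0 [<=] \sum_(i <- s) F i.
Proof.
move=> F0; elim: s => [|i s ih]; first by rewrite big_nil; exact: leL_refl.
by rewrite big_cons -[X in X [<=] _]addr0; exact: leLD.
Qed.

Lemma le_int f g : f [<=] g -> intL f <= intL g.
Proof.
move=> /subL_ge0/ge0LP fg; rewrite -subr_ge0 -intB.
rewrite /intL (@ae_Rintegral _ (fun x => `|Lp_fun (g - f) x|)).
- exact: Rintegral_ge0.
- exact: L1_measurable.
- by apply: measurableT_comp => //; exact: L1_measurable.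
- by apply: filterS fg => x /ger0_norm.
Qed.

Lemma int_ge0 f : 0 [<=] f -> 0 <= intL f.
Proof. by move=> /le_int; rewrite int0. Qed.

Lemma normL_ge0 f : 0 [<=] f -> `|f| = intL f.
Proof.
move=> /ge0LP f0; rewrite L1_normE; apply: ae_Rintegral.
- by apply: measurableT_comp => //; exact: L1_measurable.
- exact: L1_measurable.
- by apply: filterS f0 => x /ger0_norm.
Qed.

Lemma int_eq0 f : 0 [<=] f -> intL f = 0 -> f = 0.
Proof. by move=> f0; rewrite -normL_ge0// => /normr0_eq0. Qed.

Lemma leL_int_eq f g : f [<=] g -> intL g <= intL f -> f = g.
Proof.
move=> fg gf; apply/esym/eqP; rewrite -subr_eq0; apply/eqP/int_eq0.
  exact/subL_ge0.
apply/eqP; rewrite eq_le int_ge0 ?andbT; last exact/subL_ge0.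
by rewrite intB subr_le0.
Qed.

Lemma densitiesP f : densities f <-> 0 [<=] f /\ intL f = 1.
Proof.
split => -[f0 f1].
  by move/ge0LP in f0; split => //; rewrite -normL_ge0.
by split; [exact/ge0LP|rewrite normL_ge0].
Qed.

(** The norm, the maximum and the truncation at a level are all expressed with
    the positive part. *)
Definition posL f : L1 m := toL1 (fun x => Num.max (f x) 0).

Lemma posLE f : {ae m, forall x, posL f x = Num.max (f x) 0}.
Proof.
apply: toL1E; apply: (@ae_integrable _ (fun x => `|f x|)).
- by apply: measurable_maxr => //; exact: L1_measurable.
- apply: aeW => x; have [|] := lerP (f x) 0; first by rewrite normr0.
  by move=> _; rewrite lexx.
- by have := integrable_abse (L1_integrable f).
Qed.

Lemma posL_ge0 f : 0 [<=] posL f.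
Proof. by apply/ge0LP; apply: filterS (posLE f) => x ->; rewrite le_max lexx orbT. Qed.

Lemma le_posL f : f [<=] posL f.
Proof. by apply: filterS (posLE f) => x ->; rewrite le_max lexx. Qed.

Lemma posL_le f g : f [<=] g -> 0 [<=] g -> posL f [<=] g.
Proof.
move=> fg /ge0LP; apply: filterS3 (posLE f) fg => x -> fg g0.
by rewrite ge_max fg.
Qed.

Lemma posL_sub f : posL f - posL (- f) = f.
Proof.
apply: L1P; near=> x.
rewrite (near (L1_funB (posL f) (posL (- f))) x)//.
rewrite (near (posLE f) x)// (near (posLE (- f)) x)// (near (L1_funN f) x)//.
by have [f0|f0] := lerP (f x) 0; have [f1|f1] := lerP (- f x) 0; lra.
Unshelve. all: by end_near. Qed.

Lemma posL_disj f : {ae m, forall x, posL f x = 0 \/ posL (- f) x = 0}.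
Proof.
near=> x.
rewrite (near (posLE f) x)// (near (posLE (- f)) x)// (near (L1_funN f) x)//.
by have [f0|f0] := lerP (f x) 0; [left|right; rewrite max_r//; lra].
Unshelve. all: by end_near. Qed.

Lemma normLE f : `|f| = intL (posL f) + intL (posL (- f)).
Proof.
rewrite L1_normE -intD; apply: ae_Rintegral.
- by apply: measurableT_comp => //; exact: L1_measurable.
- exact: L1_measurable.
near=> x.
rewrite (near (Lp_funD (posL f) (posL (- f))) x)//.
rewrite (near (posLE f) x)// (near (posLE (- f)) x)// (near (L1_funN f) x)//.
have [f0|f0] := lerP (f x) 0; first by rewrite ler0_norm// max_l; lra.
by rewrite gtr0_norm// max_r; lra.
Unshelve. all: by end_near. Qed.

Lemma int_posL_le_norm f : intL (posL f) <= `|f|.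
Proof. by rewrite normLE lerDl int_ge0//; exact: posL_ge0. Qed.

Lemma norm_posL f : `|f| = 2 * intL (posL f) - intL f.
Proof. by rewrite normLE -{4}(posL_sub f) intB; lra. Qed.

Lemma ler_norm_int f : `|intL f| <= `|f|.
Proof.
rewrite -{1}(posL_sub f) intB normLE ler_norml.
have := int_ge0 (posL_ge0 f); have := int_ge0 (posL_ge0 (- f)).
by move=> ? ?; apply/andP; split; lra.
Qed.

Lemma le_posL_add f g : posL (f + g) [<=] posL f + posL g.
Proof.
apply: posL_le; first by apply: leLD; exact: le_posL.
by rewrite -[X in X [<=] _]addr0; apply: leLD; exact: posL_ge0.
Qed.

Lemma int_posL_add f g : intL (posL (f + g)) <= intL (posL f) + intL (posL g).
Proof. by rewrite -intD; apply: le_int; exact: le_posL_add. Qed.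

Lemma L1_norm_le (C : R) f g : {ae m, forall x, `|f x| <= C * `|g x|} -> `|f| <= C * `|g|.
Proof.
move=> fg; have iF := integrable_abse (L1_integrable f).
have iG := integrableZl measurableT C (integrable_abse (L1_integrable g)).
rewrite !L1_normE -RintegralZl//; last exact: (integrable_abse (L1_integrable g)).
apply: fine_le; [exact: integrable_fin_num iF|exact: integrable_fin_num iG|].
rewrite [leRHS](_ : _ = \int[m]_x `|C * `|g x| |%:E)%E; last first.
  apply: ae_eq_integral => //.
  - by apply: measurable_int iG.
  - by apply/measurable_EFinP; apply: measurableT_comp => //;
      apply/measurable_EFinP; apply: measurable_int iG.
  - apply: filterS fg => x fg _.
    by rewrite /= (ger0_norm (le_trans (normr_ge0 _) fg)).
apply: ae_ge0_le_integral => //.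
- by apply: measurable_int iF.
- by apply/measurable_EFinP; apply: measurableT_comp => //;
    apply/measurable_EFinP; apply: measurable_int iG.
- by apply: filterS fg => x fg _; rewrite lee_fin (le_trans fg)// ler_norm.
Qed.

Definition restr A f : L1 m := toL1 (fun x => f x * \1_A x).

Lemma indic_bound A (x : T) : `|\1_A x : R| <= 1.
Proof. by rewrite indicE; case: (_ \in _); rewrite ?normr1 ?normr0. Qed.

Lemma integrable_restr A f : measurable A ->
  m.-integrable setT (EFin \o (fun x => f x * \1_A x)).
Proof.
move=> mA; apply: (@ae_integrable _ (fun x => `|f x|)).
- by apply: measurable_funM; [exact: L1_measurable|exact: measurable_indic].
- by apply: aeW => x; rewrite normrM ler_piMr// indic_bound.
- by have := integrable_abse (L1_integrable f).
Qed.

Lemma restrE A f : measurable A -> {ae m, forall x, restr A f x = f x * \1_A x}.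
Proof. by move=> mA; apply: toL1E; exact: integrable_restr. Qed.

Lemma int_restr A f : measurable A -> intL (restr A f) = \int[m]_(x in A) f x.
Proof.
move=> mA; rewrite int_toL1; last exact: integrable_restr.
rewrite [RHS]Rintegral_mkcond; apply: eq_Rintegral => x _.
by rewrite patchE indicE; case: ifP => xA; rewrite ?mulr1 ?mulr0.
Qed.

Lemma restr_ge0 A f : measurable A -> 0 [<=] f -> 0 [<=] restr A f.
Proof.
move=> mA /ge0LP f0; apply/ge0LP; apply: filterS2 (restrE f mA) f0 => x -> f0.
by rewrite mulr_ge0.
Qed.

Lemma restr_le A f : measurable A -> 0 [<=] f -> restr A f [<=] f.
Proof.
move=> mA /ge0LP; apply: filterS2 (restrE f mA) => x -> f0.
by rewrite ler_piMr// (le_trans (ler_norm _))// indic_bound.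
Qed.

Lemma restrC A f : measurable A -> restr (~` A) f = f - restr A f.
Proof.
move=> mA; apply: L1P; near=> x.
rewrite (near (L1_funB f (restr A f)) x)// (near (restrE f mA) x)//.
rewrite (near (restrE f (measurableC mA)) x)// !indicE in_setC.
by case: (_ \in _) => /=; lra.
Unshelve. all: by end_near. Qed.

Lemma restrD A f g : measurable A -> restr A (f + g) = restr A f + restr A g.
Proof.
move=> mA; apply: L1P; near=> x.
rewrite (near (restrE (f + g) mA) x)// (near (Lp_funD (restr A f) (restr A g)) x)//.
rewrite (near (restrE f mA) x)// (near (restrE g mA) x)// (near (Lp_funD f g) x)//.
by rewrite mulrDl.
Unshelve. all: by end_near. Qed.

Lemma restrZ A a f : measurable A -> restr A (a *: f) = a *: restr A f.
Proof.
move=> mA; apply: L1P; near=> x.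
rewrite (near (restrE (a *: f) mA) x)// (near (Lp_funZ a (restr A f)) x)//.
by rewrite (near (restrE f mA) x)// (near (Lp_funZ a f) x)// mulrA.
Unshelve. all: by end_near. Qed.

Lemma restrB A f g : measurable A -> restr A (f - g) = restr A f - restr A g.
Proof.
by move=> mA; rewrite -(scaleN1r g) restrD// restrZ// scaleN1r.
Qed.

Lemma restr_sum A (I : Type) (s : seq I) (F : I -> L1 m) : measurable A ->
  restr A (\sum_(i <- s) F i) = \sum_(i <- s) restr A (F i).
Proof.
move=> mA; elim: s => [|i s ih]; last by rewrite !big_cons restrD// ih.
rewrite !big_nil; apply: L1P.
by apply: filterS2 (restrE 0 mA) L1_fun0 => x -> ->; rewrite mul0r.
Qed.

Lemma restr_id A f : measurable A -> {ae m, forall x, ~ A x -> f x = 0} ->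
  restr A f = f.
Proof.
move=> mA fA; apply: L1P; apply: filterS2 (restrE f mA) fA => x -> fA.
rewrite indicE; case: (boolP (x \in A)) => xA; first by rewrite mulr1.
by rewrite fA ?mul0r//; move/negP: xA => /[!inE].
Qed.

Lemma restrK A f : measurable A -> restr A (restr A f) = restr A f.
Proof.
move=> mA; apply: restr_id => //; apply: filterS (restrE f mA) => x -> nAx.
by rewrite indicE memNset// mulr0.
Qed.

Lemma restr_mono A f g : measurable A -> f [<=] g -> restr A f [<=] restr A g.
Proof.
move=> mA; apply: filterS3 (restrE f mA) (restrE g mA) => x -> -> fg.
by rewrite ler_wpM2r.
Qed.

Definition oneL : L1 m := toL1 (cst 1).

Lemma oneLE : {ae m, forall x, oneL x = 1}.
Proof. by apply: toL1E; exact: finite_measure_integrable_cst. Qed.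

Lemma oneL_ge0 : 0 [<=] oneL.
Proof. by apply/ge0LP; apply: filterS oneLE => x ->. Qed.

Lemma int_restr_oneL A : measurable A -> intL (restr A oneL) = fine (m A).
Proof.
move=> mA; have -> : fine (m A) = \int[m]_x \1_A x.
  by rewrite /Rintegral integral_indic// setIT.
apply: ae_Rintegral.
- exact: L1_measurable.
- exact: measurable_indic.
- by apply: filterS2 (restrE oneL mA) oneLE => x -> ->; rewrite mul1r.
Qed.

Lemma restr_setT f : restr setT f = f.
Proof. by apply: restr_id => //; apply: aeW => x /(_ I). Qed.

Lemma int_oneL : intL oneL = 1.
Proof.
by rewrite -(restr_setT oneL) int_restr_oneL// [m _]probability_setT.
Qed.

(** Testing against the indicator of the set where the inequality fails. *)
Lemma leL_test f g :
  (forall A, measurable A -> intL (restr A f) <= intL (restr A g)) -> f [<=] g.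
Proof.
move=> fg; pose A := [set x | g x < f x].
have mA : measurable A.
  by rewrite -[A]setTI; apply: measurable_fun_ltr => //; exact: L1_measurable.
have gf : restr A g = restr A f.
  apply: leL_int_eq (fg _ mA).
  apply: filterS2 (restrE g mA) (restrE f mA) => x -> ->; rewrite indicE.
  by case: (boolP (x \in A)) => [/set_mem/ltW|]; rewrite ?mulr1 ?mulr0.
have e : {ae m, forall x, restr A f x = g x * \1_A x} by rewrite -gf; exact: restrE.
apply: filterS2 e (restrE f mA) => x -> e; rewrite leNgt; apply/negP => gfx.
by move: e; rewrite indicE mem_set// !mulr1 => e; rewrite e ltxx in gfx.
Qed.

End L1_lattice.

Local Notation "f [<=] g" := (leL f g) (at level 70).

(** * Completeness of L1 *)

Section L1_complete.
Context d (T : measurableType d) (R : realType) (m : probability T R).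
Implicit Types (f g h : L1 m) (A : set T).

Lemma L1_dominated (u : nat -> L1 m) (v : T -> R) (G : T -> \bar R) :
  measurable_fun setT v ->
  {ae m, forall x, u n x @[n --> \oo] --> v x} ->
  m.-integrable setT G -> {ae m, forall x, forall n, (`|u n x|%:E <= G x)%E} ->
  m.-integrable setT (EFin \o v) /\ u n @[n --> \oo] --> toL1 m v.
Proof.
move=> mv uv iG uG.
have [||||iv uv0 _] := @dominated_convergence _ _ _ m setT measurableT
  (fun n => EFin \o u n) (EFin \o v) G _ _ _ iG.
- by move=> n; exact/measurable_EFinP/L1_measurable.
- exact/measurable_EFinP.
- apply: filterS uv => x ux _.
  by apply: (@cvg_comp _ _ _ _ EFin _ (nbhs (v x))).
- by apply: filterS uG => x ux n _; exact: ux.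
split => //; apply/subr_cvg0/norm_cvg0P.
have -> : (fun n => `|u n - toL1 m v|) =
    fine \o (fun n => \int[m]_x `|(EFin \o u n) x - (EFin \o v) x|)%E.
  apply/funext => n /=; rewrite L1_normE; apply: ae_Rintegral.
  - by apply: measurableT_comp => //; exact: L1_measurable.
  - by apply: measurableT_comp => //; apply: measurable_funB.
  - by apply: filterS2 (L1_funB (u n) (toL1 m v)) (toL1E iv) => x -> ->.
exact: (@fine_cvg _ _ _ _ _ 0).
Qed.

(** The sum S of the absolute increments is integrable, hence finite almost
    everywhere; there the sequence converges, dominated by the absolute value of
    its first term plus S. *)
Lemma L1_summable_cvg (v : nat -> L1 m) :
  (forall k, `|v k.+1 - v k| <= 1 / (2 ^ k.+1)%:R) ->
  exists l : L1 m, v n @[n --> \oo] --> l.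
Proof.
move=> vk; pose D k x := v k.+1 x - v k x.
have mD k : measurable_fun setT (D k).
  by apply: measurable_funB; exact: L1_measurable.
pose S x := (\sum_(k <oo) `|D k x|%:E)%E.
have mS : measurable_fun setT S.
  apply: ge0_emeasurable_sum => //.
  by move=> k _; apply/measurable_EFinP/measurableT_comp.
have S0 x : (0 <= S x)%E by apply: nneseries_ge0 => k _ _; rewrite lee_fin.
have iS : m.-integrable setT S.
  apply/integrableP; split => //.
  under eq_integral do rewrite gee0_abs//.
  rewrite /S integral_nneseries//; last first.
    by move=> k; apply/measurable_EFinP/measurableT_comp.
  apply: (@le_lt_trans _ _ (\sum_(k <oo) (1 / (2 ^ k.+1)%:R)%:E)%E).
    apply: lee_nneseries => k => [_ _|_]; first exact: integral_ge0.
    have := vk k; rewrite -lee_fin; apply: le_trans.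
    have iD : m.-integrable setT (EFin \o (fun x => `|D k x|)).
      have iD : m.-integrable setT (EFin \o D k).
        by have := integrableB measurableT (L1_integrable (v k.+1))
          (L1_integrable (v k)).
      by have := integrable_abse iD.
    rewrite L1_normE -[X in (X <= _)%E]fineK; last exact: integrable_fin_num.
    rewrite lee_fin le_eqVlt; apply/orP; left; apply/eqP.
    apply: ae_Rintegral.
    - exact: measurableT_comp.
    - by apply: measurableT_comp => //; exact: L1_measurable.
    - by apply: filterS (L1_funB (v k.+1) (v k)) => x ->.
  by rewrite (le_lt_trans (epsilon_trick0 xpredT ler01))// ltry.
(* The upper limit is measurable whether or not the sequence converges. *)
pose V x := fine (limn_esup (fun n => (v n x)%:E)).
have mV : measurable_fun setT V.
  apply: measurableT_comp => //; apply: measurable_fun_limn_esup => n.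
  exact/measurable_EFinP/L1_measurable.
have vE n x : v n x = v 0%N x + series (D^~ x) n.
  elim: n => [|n ih]; first by rewrite seriesEnat/= big_geq// addr0.
  by rewrite seriesSr addrA -ih /D addrC subrK.
exists (toL1 m V).
apply: (proj2 (@L1_dominated _ _ (fun x => `|v 0%N x|%:E + S x)%E _ _ _ _)) => //.
- apply: filterS (integrable_ae measurableT iS) => x /= /(_ I) Sx.
  have /cvg_ex[l cl] : cvgn (series (D^~ x)).
    apply: normed_cvg; apply: nondecreasing_is_cvgn.
      by apply: nondecreasing_series => k _ _ /=.
    exists (fine (S x)) => _ [n _ <-]; rewrite -lee_fin fineK//.
    rewrite /series /= -sumEFin; apply: nneseries_lim_ge => k _ _.
    by rewrite lee_fin.
  have vc : v n x @[n --> \oo] --> v 0%N x + l.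
    under eq_fun do rewrite vE; apply: cvgD => //; exact: cvg_cst.
  suff -> : V x = v 0%N x + l by [].
  have /cvg_limn_einf_sup[_ VE] : (v n x)%:E @[n --> \oo] --> (v 0%N x + l)%:E.
    by apply: (@cvg_comp _ _ _ _ EFin _ (nbhs (v 0%N x + l))).
  by rewrite /V VE.
- apply: integrableD => //.
  by have := integrable_abse (L1_integrable (v 0%N)).
- apply: aeW => x n; rewrite vE.
  have : (`|v 0%N x + series (D^~ x) n| <= `|v 0%N x| + \sum_(0 <= k < n) `|D k x|).
    by rewrite (le_trans (ler_normD _ _))// lerD2l ler_norm_sum.
  rewrite -lee_fin => /le_trans; apply; rewrite EFinD leeD2l// -sumEFin.
  by apply: nneseries_lim_ge => k _ _; rewrite lee_fin.
Qed.

Lemma L1_complete (u : nat -> L1 m) :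
  (forall e, 0 < e -> exists N, forall i j, (N <= i)%N -> (N <= j)%N ->
     `|u i - u j| <= e) ->
  exists l : L1 m, u n @[n --> \oo] --> l.
Proof.
move=> uC.
have /choice[N HN] k : exists N, forall i j, (N <= i)%N -> (N <= j)%N ->
    `|u i - u j| <= 1 / (2 ^ k.+1)%:R.
  by apply: uC; rewrite divr_gt0// ltr0n expn_gt0.
pose n k := (\sum_(i < k.+1) (N i).+1)%N.
have nS k : (n k <= n k.+1)%N by rewrite {2}/n big_ord_recr/= leq_addr.
have Nn k : (N k <= n k)%N.
  by rewrite /n big_ord_recr/= (leq_trans (leqnSn _))// leq_addl.
have kn k : (k <= n k)%N.
  elim: k => // k ih; rewrite /n big_ord_recr/= -/(n k) addnS ltnS.
  by rewrite (leq_trans ih)// leq_addr.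
have [l ul] : exists l : L1 m, u (n k) @[k --> \oo] --> l.
  by apply: L1_summable_cvg => k; rewrite HN// (leq_trans (Nn k)).
exists l; apply/cvgrPdist_le => e e0.
have e20 : 0 < e / 2 by rewrite divr_gt0.
have [M HM] := uC _ e20.
move/cvgrPdist_le : ul => /(_ _ e20)[K _ HK].
exists M => // i /= Mi; pose k := maxn K M.
rewrite -(subrK (u (n k)) l) -addrA (le_trans (ler_normD _ _))//.
rewrite (splitr e) lerD//; first by apply: HK; exact: leq_maxl.
by apply: HM => //; rewrite (leq_trans _ (kn k))// leq_maxr.
Qed.

End L1_complete.

(** * The dual of L1 and the adjoint of an operator *)

Section Linf.
Context d (T : measurableType d) (R : realType) (m : probability T R).
Implicit Types (f g h : L1 m) (k : Linf m) (A : set T).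

Lemma Linf_measurable k : measurable_fun setT (k : T -> R).
Proof. by have /andP[/[!inE]] := LfunP (repr k). Qed.

Lemma Linf_bounded k : exists2 C : R, 0 <= C & {ae m, forall x, `|k x| <= C}.
Proof.
have /andP[_ /[!inE]/=] := LfunP (repr k).
rewrite /finite_norm Lnorm.unlock /Lnorm.
have -> : (0 < m [set: T])%E by rewrite [m _]probability_setT.
set S := ess_sup _ _ => Soo.
have /ess_supP kS : (S <= (Num.max 0 (fine S))%:E)%E.
  move: Soo; case: S => [r||]//= _; first by rewrite lee_fin le_max lexx orbT.
  by rewrite leNye.
exists (Num.max 0 (fine S)); first by rewrite le_max lexx.
by apply: filterS kS => x /=; rewrite lee_fin.
Qed.

Lemma Linf_intro (u : T -> R) C : measurable_fun setT u ->
  {ae m, forall x, `|u x| <= C} -> exists k : Linf m, {ae m, forall x, k x = u x}.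
Proof.
move=> mu uC; exists (Lp_class (leey 1%E) u); apply: Lp_classK.
rewrite inE; apply/andP; split; rewrite inE//= /finite_norm Lnorm.unlock /Lnorm.
case: ifPn => // _; rewrite (@le_lt_trans _ _ C%:E) ?ltry//; apply/ess_supP.
by apply: filterS uC => x; rewrite /= lee_fin.
Qed.

Lemma integrable_mul_Linf f k : m.-integrable setT (EFin \o (fun x => f x * k x)).
Proof.
have [C C0 kC] := Linf_bounded k.
apply: (@ae_integrable _ _ _ _ _ (fun x => C * `|f x|)).
- by apply: measurable_funM; [exact: L1_measurable|exact: Linf_measurable].
- by apply: filterS kC => x kC; rewrite normrM mulrC ler_wpM2r.
- by have := integrableZl measurableT C (integrable_abse (L1_integrable f)).
Qed.

Definition pairing f k : R := \int[m]_x (f x * k x).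

Lemma pairingE f k (g : L1 m) : {ae m, forall x, g x = f x * k x} ->
  pairing f k = intL g.
Proof.
move=> gE; apply: ae_Rintegral.
- by apply: measurable_funM; [exact: L1_measurable|exact: Linf_measurable].
- exact: L1_measurable.
- by apply: filterS gE => x ->.
Qed.

Definition mulL f k : L1 m := toL1 m (fun x => f x * k x).

Lemma mulLE f k : {ae m, forall x, mulL f k x = f x * k x}.
Proof. by apply: toL1E; exact: integrable_mul_Linf. Qed.

Lemma pairing_mulL f k : pairing f k = intL (mulL f k).
Proof. exact/pairingE/mulLE. Qed.

Lemma pairingP k a f g : pairing (a *: f + g) k = a * pairing f k + pairing g k.
Proof.
rewrite !pairing_mulL -intZ -intD; congr intL; apply: L1P; near=> x.
rewrite (near (mulLE (a *: f + g) k) x)// (near (Lp_funD (a *: f) g) x)//.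
rewrite (near (Lp_funD (a *: mulL f k) (mulL g k)) x)//.
rewrite (near (Lp_funZ a (mulL f k)) x)// (near (Lp_funZ a f) x)//.
by rewrite (near (mulLE f k) x)// (near (mulLE g k) x)// mulrDl mulrA.
Unshelve. all: by end_near. Qed.

Lemma pairing_bounded k : exists2 C : R, 0 <= C & forall f, `|pairing f k| <= C * `|f|.
Proof.
have [C C0 kC] := Linf_bounded k; exists C => // f.
rewrite pairing_mulL (le_trans (ler_norm_int _))//; apply: L1_norm_le.
by apply: filterS2 (mulLE f k) kC => x -> kC; rewrite normrM mulrC ler_wpM2r.
Qed.

Lemma pairing_le k k' : (forall f, leL 0 f -> pairing f k <= pairing f k') ->
  {ae m, forall x, k x <= k' x}.
Proof.
move=> kk'; have : leL (mulL (oneL m) k) (mulL (oneL m) k').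
  apply: leL_test => A mA.
  have e (k0 : Linf m) : restr A (mulL (oneL m) k0) = mulL (restr A (oneL m)) k0.
    apply: L1P; near=> x; rewrite (near (restrE (mulL (oneL m) k0) mA) x)//.
    rewrite (near (mulLE (oneL m) k0) x)// (near (mulLE (restr A (oneL m)) k0) x)//.
    by rewrite (near (restrE (oneL m) mA) x)// mulrAC.
  by rewrite !e -!pairing_mulL; apply: kk'; apply: restr_ge0 => //; exact: oneL_ge0.
move=> le; near=> x.
have : Lp_fun (mulL (oneL m) k) x <= Lp_fun (mulL (oneL m) k') x by near: x.
rewrite (near (mulLE (oneL m) k) x)// (near (mulLE (oneL m) k') x)//.
by rewrite (near (oneLE m) x)// !mul1r.
Unshelve. all: by end_near. Qed.

Lemma pairing_indic A f : measurable A ->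
  pairing f (indic_class m A) = intL (restr A f).
Proof.
move=> mA; apply: pairingE.
by apply: filterS2 (restrE f mA) (indic_classE m mA) => x -> ->.
Qed.

Lemma pairing_unit_interval k :
  (forall f, leL 0 f -> 0 <= pairing f k <= intL f) ->
  {ae m, forall x, 0 <= k x <= 1}.
Proof.
move=> kf.
have k0 : {ae m, forall x, (0 : Linf m) x <= k x}.
  apply: pairing_le => f f0; rewrite (_ : pairing f 0 = 0).
    by case/andP: (kf f f0).
  rewrite -(int0 m); apply: pairingE.
  by apply: filterS2 (L1_fun0 m) (Lp_fun0 m (leey 1%E)) => x -> ->; rewrite mulr0.
have k1 : {ae m, forall x, k x <= indic_class m setT x}.
  apply: pairing_le => f f0; rewrite pairing_indic// restr_setT.
  by case/andP: (kf f f0).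
apply: filterS3 (filterI (indic_classE m measurableT) (Lp_fun0 m (leey 1%E))) k0 k1.
by move=> x [-> ->]; rewrite indicT => -> ->.
Qed.

End Linf.

Section bounded_functional.
Context d (T : measurableType d) (R : realType) (m : probability T R).
Variables (Phi : L1 m -> R) (C : R).
Hypothesis PhiP : forall a f g, Phi (a *: f + g) = a * Phi f + Phi g.
Hypothesis PhiC : forall f, `|Phi f| <= C * `|f|.
Implicit Types (f g h : L1 m) (k : Linf m) (A : set T).

Lemma functional0 : Phi 0 = 0.
Proof. by have := PhiP (-1) 0 0; rewrite scaleN1r oppr0 addr0 mulN1r addNr. Qed.

Lemma functionalD f g : Phi (f + g) = Phi f + Phi g.
Proof. by rewrite -[f in LHS]scale1r PhiP mul1r. Qed.

Lemma functionalZ a f : Phi (a *: f) = a * Phi f.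
Proof. by rewrite -[a *: f]addr0 PhiP functional0 addr0. Qed.

Lemma functionalB f g : Phi (f - g) = Phi f - Phi g.
Proof. by rewrite -scaleN1r addrC PhiP mulN1r addrC. Qed.

Lemma functional_sum (I : Type) (s : seq I) (F : I -> L1 m) :
  Phi (\sum_(i <- s) F i) = \sum_(i <- s) Phi (F i).
Proof.
by elim: s => [|i s ih]; rewrite ?big_nil ?functional0// !big_cons functionalD ih.
Qed.

Lemma functional_cvg (u : nat -> L1 m) f : u n @[n --> \oo] --> f ->
  Phi (u n) @[n --> \oo] --> Phi f.
Proof.
move=> uf; apply/subr_cvg0; apply: norm_cvg0.
have CV : C * `|u n - f| @[n --> \oo] --> (0 : R).
  rewrite -[X in _ --> X](mulr0 C); apply: cvgM; first exact: cvg_cst.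
  by apply/norm_cvg0P; apply/subr_cvg0.
apply: (@squeeze_cvgr _ _ _ _ (cst 0) _ _ _ _ _ CV); last exact: cvg_cst.
by apply: nearW => n; rewrite normr_ge0 -functionalB PhiC.
Qed.

End bounded_functional.

Section Riesz.
Import HBSimple.
Context d (T : measurableType d) (R : realType) (m : probability T R).
Variables (Phi : L1 m -> R) (C : R).
Hypothesis PhiP : forall a f g, Phi (a *: f + g) = a * Phi f + Phi g.
Hypothesis PhiC : forall f, `|Phi f| <= C * `|f|.
Implicit Types (f g h : L1 m) (k : Linf m) (A : set T).

Lemma integrable_indic A : measurable A -> m.-integrable setT (EFin \o (\1_A : T -> R)).
Proof.
move=> mA; apply: (@ae_integrable _ _ _ _ _ (cst 1)).
- exact: measurable_indic.
- by apply: aeW => x; exact: indic_bound.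
- exact: finite_measure_integrable_cst.
Qed.

Lemma functional_bigcup (F : nat -> set T) : (forall i, measurable (F i)) ->
  trivIset setT F ->
  Phi (\sum_(i < n) toL1 m \1_(F i)) @[n --> \oo] --> Phi (toL1 m \1_(\bigcup_i F i)).
Proof.
move=> mF tF; apply: (functional_cvg PhiP PhiC).
have mU : measurable (\bigcup_i F i) by exact: bigcup_measurable.
have e : {ae m, forall x n, Lp_fun (\sum_(i < n) toL1 m \1_(F i)) x =
    \sum_(i < n) \1_(F i) x}.
  apply: ae_foralln => n; apply: L1_fun_sum => i.
  by apply: toL1E; exact: integrable_indic.
have sumE x j n : F j x -> (\sum_(i < n) \1_(F i) x : R) = (j < n)%:R.
  move=> Fjx; have F0 i : i != j -> \1_(F i) x = 0 :> R.
    move=> ik; rewrite indicE memNset// => Fix.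
    by move/eqP: ik; apply; apply: (tF i j) => //; exists x.
  have [kn|nk] := ltnP j n.
    rewrite (bigD1 (Ordinal kn))//= indicE mem_set// big1 ?addr0// => i.
    by move=> ik; apply: F0; apply: contra ik => /eqP ik; exact/eqP/val_inj.
  by rewrite big1// => i _; apply: F0; rewrite ltn_eqF// (leq_trans _ nk).
have sum0 x n : ~ (\bigcup_i F i) x -> (\sum_(i < n) \1_(F i) x : R) = 0.
  by move=> nU; rewrite big1// => i _; rewrite indicE memNset// => Fi; apply: nU; exists i.
apply: (proj2 (@L1_dominated _ _ _ m _ _ (cst 1%E) _ _ _ _)).
- exact: measurable_indic.
- apply: filterS e => x ex; under eq_fun do rewrite ex.
  have [[j _ Fj]|nU] := pselect ((\bigcup_i F i) x).
    rewrite indicE mem_set; last by exists j.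
    apply: cvg_near_cst; exists j.+1 => // n /= kn.
    by rewrite (sumE _ j)// kn.
  rewrite indicE memNset//; apply: cvg_near_cst; apply: nearW => n.
  by rewrite sum0.
- exact: (finite_measure_integrable_cst m 1 measurableT).
- apply: filterS e => x ex n; rewrite ex lee_fin.
  have [[j _ Fj]|nU] := pselect ((\bigcup_i F i) x).
    by rewrite (sumE _ j)//; case: (_ < _)%N; rewrite ?normr1 ?normr0.
  by rewrite sum0// normr0.
Qed.

Definition functional_charge A : \bar R := (Phi (toL1 m \1_A))%:E.

Let functional_charge0 : functional_charge set0 = 0%E.
Proof.
rewrite /functional_charge (_ : toL1 m _ = 0) ?(functional0 PhiP)//.
apply: L1P; apply: filterS2 (toL1E (integrable_indic measurable0)) (L1_fun0 m) => x -> ->.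
by rewrite indic0.
Qed.

Let functional_charge_fin A : measurable A -> functional_charge A \is a fin_num.
Proof. by []. Qed.

Let functional_charge_additive : semi_sigma_additive functional_charge.
Proof.
move=> F mF tF _; rewrite /functional_charge.
under eq_fun do rewrite sumEFin.
apply: (@cvg_comp _ _ _ _ EFin _ (nbhs (Phi (toL1 m \1_(\bigcup_n F n))))) => //.
under eq_fun do rewrite big_mkord -(functional_sum PhiP).
exact: functional_bigcup.
Qed.

HB.instance Definition _ := isCharge.Build _ _ _ functional_charge
  functional_charge0 functional_charge_fin functional_charge_additive.

Lemma functional_indic : exists k : Linf m, forall A, measurable A ->
  Phi (toL1 m \1_A) = pairing (toL1 m \1_A) k.
Proof.
have dom : functional_charge `<< m.
  apply/null_content_dominatesP => A mA A0.
  rewrite /functional_charge (_ : toL1 m _ = 0) ?(functional0 PhiP)//.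
  apply: L1P; have A0' : {ae m, forall x, \1_A x = 0 :> R}.
    exists A; split => // x /= xA; apply: contrapT => nAx.
    by apply: xA; rewrite indicE memNset.
  by apply: filterS3 (toL1E (integrable_indic mA)) (L1_fun0 m) A0' => x -> ->.
have iD := Radon_Nikodym_integrable dom.
pose D x := fine (Radon_Nikodym functional_charge m x).
have DE : EFin \o D = Radon_Nikodym functional_charge m.
  by apply/funext => x; rewrite /= fineK// Radon_Nikodym_fin_num.
have iD' : m.-integrable setT (EFin \o D) by rewrite DE.
have mD : measurable_fun setT D by have /measurable_int/measurable_EFinP := iD'.
have intD A : measurable A -> Phi (toL1 m \1_A) = intL (restr A (toL1 m D)).
  move=> mA; rewrite int_restr//.
  have /(congr1 fine) := Radon_Nikodym_integral dom mA.
  rewrite /functional_charge [LHS]/= => ->; congr fine; rewrite -DE.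
  apply: ae_eq_integral => //.
  - exact/measurable_EFinP/measurable_funTS.
  - by apply/measurable_EFinP/measurable_funTS; exact: L1_measurable.
  - by apply: filterS (toL1E iD') => x /= -> _.
have one A : measurable A -> toL1 m \1_A = restr A (oneL m).
  move=> mA; apply: L1P; apply: filterS3 (toL1E (integrable_indic mA))
    (restrE (oneL m) mA) (oneLE m) => x -> -> ->.
  by rewrite mul1r.
have bound A : measurable A ->
    `|intL (restr A (toL1 m D))| <= intL (restr A (C *: oneL m)).
  move=> mA; rewrite -intD// restrZ// intZ (le_trans (PhiC _))// one//.
  by rewrite normL_ge0//; apply: restr_ge0 => //; exact: oneL_ge0.
have [k kD] : exists k : Linf m, {ae m, forall x, k x = D x}.
  apply: (@Linf_intro _ _ _ _ _ C) => //.
  have le1 : leL (toL1 m D) (C *: oneL m).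
    by apply: leL_test => A mA; exact: le_trans (ler_norm _) (bound _ mA).
  have le2 : leL (- toL1 m D) (C *: oneL m).
    apply: leL_test => A mA; apply: le_trans (bound _ mA).
    by rewrite -scaleN1r restrZ// intZ mulN1r -normrN ler_norm.
  near=> x.
  have := near le1 x; have := near le2 x => /(_ _) + /(_ _).
  rewrite (near (Lp_funZ C (oneL m)) x)// (near (oneLE m) x)//.
  rewrite (near (L1_funN (toL1 m D)) x)// (near (toL1E iD') x)// mulr1 => l2 l1.
  by rewrite ler_norml lerNl l1// l2.
exists k => A mA; rewrite intD//; apply/esym/pairingE.
apply: filterS3 (filterI (restrE (toL1 m D) mA) (toL1E iD')) kD
  (toL1E (integrable_indic mA)) => x [-> ->] -> ->.
by rewrite mulrC.
Unshelve. all: by end_near. Qed.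

(** The density is that of the charge sending A to Phi 1_A; both sides are
    continuous and agree on simple functions, which are dense. *)
Theorem L1_dual : exists k : Linf m, forall f, Phi f = pairing f k.
Proof.
have [k kA] := functional_indic; exists k.
have [K K0 kK] := pairing_bounded k.
have kP := pairingP k.
move=> f; have [g [ig _ gf]] := approximation_sfun_integrable measurableT (L1_integrable f).
pose u n : L1 m := toL1 m (fun x => g n x).
have simple n : Phi (u n) = pairing (u n) k.
  pose r : seq R := finmap.enum_fset (fset_set (range (g n))).
  have -> : u n = \sum_(y <- r)
      y *: toL1 m \1_(g n @^-1` [set y]).
    apply: L1P; have := @L1_fun_sum _ _ _ m _ r
      (fun y => y *: toL1 m \1_(g n @^-1` [set y]))
      (fun y x => y * \1_(g n @^-1` [set y]) x).
    move=> /(_ _)/wrap[y|sumE].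
      have mg : measurable (g n @^-1` [set y]) by exact: measurable_funPTI.
      by apply: filterS2 (Lp_funZ y (toL1 m \1_(g n @^-1` [set y])))
        (toL1E (integrable_indic mg)) => x -> ->.
    apply: filterS2 sumE (toL1E (ig n)) => x -> ->.
    by rewrite fimfunE fsbig_finite.
  rewrite (functional_sum PhiP) (functional_sum kP); apply: eq_bigr => y _.
  by rewrite (functionalZ PhiP) (functionalZ kP) kA//; exact: measurable_funPTI.
have uf : u n @[n --> \oo] --> f.
  apply/subr_cvg0/norm_cvg0P.
  have -> : (fun n => `|u n - f|) =
      fine \o (fun n => \int[m]_x `|(EFin \o f) x - (g n x)%:E|)%E.
    apply/funext => n /=; rewrite L1_normE; apply: ae_Rintegral.
    - by apply: measurableT_comp => //; exact: L1_measurable.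
    - by apply: measurableT_comp => //; apply: measurable_funB.
    - by apply: filterS2 (L1_funB (u n) f) (toL1E (ig n)) => x -> ->; rewrite distrC.
  exact: (@fine_cvg _ _ _ _ _ 0).
have := functional_cvg PhiP PhiC uf; have := functional_cvg kP kK uf.
under eq_fun do rewrite -simple.
by move=> /cvg_lim <-// /cvg_lim <-.
Qed.

End Riesz.

(** * Markov operators *)

Section Markov_basics.
Context d (T : measurableType d) (R : realType) (m : probability T R).
Variables (P : L1 m -> L1 m) (MP : Markov P).
Implicit Types (f g h : L1 m) (A : set T).

Lemma MarkovP a f g : P (a *: f + g) = a *: P f + P g.
Proof. by case: MP => lP _ _; exact: lP. Qed.

Lemma Markov_ge0 f : 0 [<=] f -> 0 [<=] P f.
Proof. by move=> /ge0LP f0; apply/ge0LP; case: MP => _ /(_ f f0). Qed.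

Lemma Markov_int f : intL (P f) = intL f.
Proof. by case: MP => _ _ /(_ f). Qed.

Lemma Markov0 : P 0 = 0.
Proof. by have := MarkovP (-1) 0 0; rewrite scaleN1r oppr0 addr0 scaleN1r addNr. Qed.

Lemma MarkovD f g : P (f + g) = P f + P g.
Proof. by rewrite -[f in LHS]scale1r MarkovP scale1r. Qed.

Lemma MarkovZ a f : P (a *: f) = a *: P f.
Proof. by rewrite -[a *: f]addr0 MarkovP Markov0 addr0. Qed.

Lemma MarkovN f : P (- f) = - P f.
Proof. by rewrite -scaleN1r MarkovZ scaleN1r. Qed.

Lemma MarkovB f g : P (f - g) = P f - P g.
Proof. by rewrite MarkovD MarkovN. Qed.

Lemma Markov_sum (I : Type) (s : seq I) (F : I -> L1 m) :
  P (\sum_(i <- s) F i) = \sum_(i <- s) P (F i).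
Proof.
by elim: s => [|i s ih]; rewrite ?big_nil ?Markov0// !big_cons MarkovD ih.
Qed.

Lemma Markov_le f g : f [<=] g -> P f [<=] P g.
Proof. by move=> /subL_ge0/Markov_ge0; rewrite MarkovB => /subL_ge0. Qed.

Lemma Markov_posL f : intL (posL (P f)) <= intL (posL f).
Proof.
rewrite -(Markov_int (posL f)); apply/le_int/posL_le.
  exact/Markov_le/le_posL.
exact/Markov_ge0/posL_ge0.
Qed.

Lemma Markov_norm f : `|P f| <= `|f|.
Proof.
have Np : intL (posL (- P f)) <= intL (posL (- f)) by rewrite -MarkovN; exact: Markov_posL.
by rewrite (normLE f) (normLE (P f)); apply: lerD Np; exact: Markov_posL.
Qed.

Lemma Markov_density f : densities f -> densities (P f).
Proof.
move=> /densitiesP[f0 f1]; apply/densitiesP.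
by rewrite Markov_int; split => //; exact: Markov_ge0.
Qed.

Lemma Markov_cvg (u : nat -> L1 m) f : u n @[n --> \oo] --> f ->
  P (u n) @[n --> \oo] --> P f.
Proof.
move=> uf; apply/subr_cvg0; apply: norm_cvg0.
have uf0 : `|u n - f| @[n --> \oo] --> (0 : R) by apply/norm_cvg0P/subr_cvg0.
apply: (@squeeze_cvgr _ _ _ _ (cst 0) _ _ _ _ _ uf0); last exact: cvg_cst.
by apply: nearW => n; rewrite normr_ge0 -MarkovB Markov_norm.
Qed.

(** This is P^* 1_A >= 1_A, written without the adjoint: the mass inside A never
    decreases. *)
Definition absorbing A : Prop :=
  forall f, 0 [<=] f -> intL (restr A f) <= intL (restr A (P f)).

Lemma Markov_supported A f : measurable A -> absorbing A -> 0 [<=] f ->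
  restr A f = f -> restr A (P f) = P f.
Proof.
move=> mA abA f0 fA; apply: leL_int_eq; first exact/restr_le/Markov_ge0.
by rewrite Markov_int -{1}fA; exact: abA.
Qed.

(** What an invariant function has in an absorbing set is sent by P into that
    set and below the function, hence below itself. *)
Lemma restr_invariant A h : measurable A -> absorbing A -> 0 [<=] h -> P h = h ->
  P (restr A h) = restr A h.
Proof.
move=> mA abA h0 Ph; have r0 := restr_ge0 mA h0.
apply: leL_int_eq; last by rewrite Markov_int.
rewrite -(Markov_supported mA abA r0 (restrK h mA)).
by apply: restr_mono => //; rewrite -{2}Ph; exact/Markov_le/restr_le.
Qed.

Lemma posL_invariant f : P f = f -> P (posL f) = posL f.
Proof.
move=> Pf; apply/esym/leL_int_eq; last by rewrite Markov_int.
apply: posL_le; first by rewrite -{1}Pf; exact/Markov_le/le_posL.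
exact/Markov_ge0/posL_ge0.
Qed.

(** [adjoint] picks some function satisfying the duality relation; that one
    exists is [L1_dual]. *)
Lemma adjointP (g : Linf m) f : pairing (P f) g = pairing f (adjoint P g).
Proof.
have [C C0 gC] := pairing_bounded g.
have [k kP] : exists k : Linf m, forall f, pairing (P f) g = pairing f k.
  apply: (@L1_dual _ _ _ _ (fun f => pairing (P f) g) C).
    by move=> a f1 f2; rewrite MarkovP pairingP.
  by move=> f1; rewrite (le_trans (gC _))// ler_wpM2l// Markov_norm.
have := @getPex _ [set k : Linf m | forall f,
    \int[m]_x (P f x * g x) = \int[m]_x (f x * k x)].
by apply; exists k.
Qed.

Lemma iter_adjointP n (g : Linf m) f :
  pairing (iter n P f) g = pairing f (iter n (adjoint P) g).
Proof. by elim: n f => // n ih f; rewrite iterSr ih adjointP. Qed.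

Lemma adjoint_absorbing A : measurable A ->
  {ae m, forall x, \1_A x <= adjoint P (indic_class m A) x} -> absorbing A.
Proof.
move=> mA leA f f0; rewrite -(pairing_indic (P f))// adjointP pairing_mulL.
apply: le_int; move/ge0LP in f0; near=> x.
rewrite (near (restrE f mA) x)// (near (mulLE f (adjoint P (indic_class m A))) x)//.
by rewrite ler_wpM2l//; near: x.
Unshelve. all: by end_near. Qed.

Lemma restr_supp h : restr (supp h) h = h.
Proof.
apply: restr_id; first exact: measurable_supp.
by apply: aeW => x /negP/negbNE/eqP.
Qed.

(** Since P h = h, the function P^* 1_(supp h) has integral 1 against h dm and
    is at most 1, so it equals 1 on supp h. *)
Lemma supp_absorbing h : 0 [<=] h -> P h = h -> absorbing (supp h).
Proof.
move=> h0 Ph; have mS := measurable_supp h; set S := supp h in mS *.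
set k := adjoint P (indic_class m S).
have kE f : pairing f k = intL (restr S (P f)).
  by rewrite -adjointP pairing_indic.
have k01 : {ae m, forall x, 0 <= k x <= 1}.
  apply: pairing_unit_interval => f f0; rewrite kE.
  have Pf0 := Markov_ge0 f0; rewrite int_ge0 -?(Markov_int f); last exact: restr_ge0.
  exact/le_int/restr_le.
have hk : mulL h k = h.
  apply: leL_int_eq.
    move/ge0LP in h0; apply: filterS3 h0 k01 (mulLE h k) => x h0 /andP[_ k1] ->.
    by rewrite ler_piMr.
  by rewrite -pairing_mulL kE Ph restr_supp.
have hk' := mulLE h k; rewrite hk in hk'.
move=> f f0; rewrite -kE pairing_mulL; apply: le_int; move/ge0LP in f0; near=> x.
rewrite (near (restrE f mS) x)// (near (mulLE f k) x)// ler_wpM2l//; first by near: x.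
rewrite indicE; have [xS|xS] := boolP (x \in S); last first.
  have : 0 <= k x <= 1 by near: x.
  by case/andP.
have hx : h x != 0 by move: xS; rewrite inE.
have /(congr1 (fun z => (h x)^-1 * z)) : h x = h x * k x by near: x.
by rewrite mulrA mulVf// mul1r => <-.
Unshelve. all: by end_near. Qed.

End Markov_basics.

Section Cesaro.
Context d (T : measurableType d) (R : realType) (m : probability T R).
Variables (P : L1 m -> L1 m) (MP : Markov P).
Implicit Types (f g h : L1 m) (A : set T).

Lemma iter_Markov n : Markov (iter n P).
Proof.
elim: n => [|n ih]; first by split.
split => [a f g|f f0|f]; rewrite ?iterS.
- by rewrite (MarkovP ih) (MarkovP MP).
- by case: MP => _ + _; apply; case: ih => _ /(_ f f0).
- by rewrite [LHS](Markov_int MP) [LHS](Markov_int ih).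
Qed.

Lemma cesaro_Markov n : Markov (cesaro_mean P n.+1).
Proof.
split => [a f g|f|f].
- rewrite /cesaro_mean scalerA mulrC -scalerA -scalerDr; congr (_ *: _).
  rewrite scaler_sumr -big_split/=; apply: eq_bigr => i _.
  exact: MarkovP (iter_Markov i) _ _ _.
- move=> /ge0LP f0; apply/ge0LP/geL0Z => //; apply: sumL_ge0 => i.
  exact: Markov_ge0 (iter_Markov i) _ f0.
- rewrite -[LHS]/(intL _) -[RHS]/(intL f) intZ int_sum.
  rewrite (eq_bigr (fun=> intL f)); last by move=> i _; exact: Markov_int (iter_Markov i) f.
  by rewrite sumr_const card_ord -[intL f *+ _]mulr_natr mulrCA mulVf ?mulr1// pnatr_eq0.
Qed.

Lemma cesaro_fix n f : P f = f -> cesaro_mean P n.+1 f = f.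
Proof.
move=> Pf; rewrite /cesaro_mean (eq_bigr (fun=> f)); last first.
  by move=> i _; exact: iter_fix.
by rewrite sumr_const card_ord -[f *+ _]scaler_nat scalerA mulVf ?scale1r// pnatr_eq0.
Qed.

Lemma cesaro_almost_invariant n f :
  `|P (cesaro_mean P n.+1 f) - cesaro_mean P n.+1 f| <= n.+1%:R^-1 * (2 * `|f|).
Proof.
rewrite /cesaro_mean (MarkovZ MP) -scalerBr normrZ ger0_norm// ler_wpM2l//.
rewrite (Markov_sum MP) -sumrB.
rewrite (eq_bigr (fun i : 'I_n.+1 => iter i.+1 P f - iter i P f))//.
rewrite -(big_mkord xpredT (fun i => iter i.+1 P f - iter i P f)) telescope_sumr//.
rewrite (le_trans (ler_normB _ _))// [X in _ + X](_ : _ = `|f|)// mulr_natl mulr2n lerD2r.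
exact: Markov_norm (iter_Markov n.+1) f.
Qed.

Lemma cesaro_comm n f : cesaro_mean P n.+1 (P f) = P (cesaro_mean P n.+1 f).
Proof.
rewrite /cesaro_mean (MarkovZ MP) (Markov_sum MP); congr (_ *: _).
by apply: eq_bigr => i _; rewrite -iterS iterSr.
Qed.

Definition cesaro_equiv phi f : Prop :=
  cesaro_mean P n.+1 f - cesaro_mean P n.+1 phi @[n --> \oo] --> (0 : L1 m).

Lemma cesaro_equiv_iter phi i : cesaro_equiv phi (iter i P phi).
Proof.
elim: i => [|i ih].
  by rewrite /cesaro_equiv; under eq_fun do rewrite subrr; exact: cvg_cst.
rewrite /cesaro_equiv -[X in _ --> X](addr0 0).
under eq_fun => n do rewrite iterS cesaro_comm
  -(subrK (cesaro_mean P n.+1 (iter i P phi)) (P _)) -addrA.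
apply: cvgD; last exact: ih.
apply: norm_cvg0.
have c0 : n.+1%:R^-1 * (2 * `|iter i P phi|) @[n --> \oo] --> (0 : R).
  by rewrite -[X in _ --> X](mul0r (2 * `|iter i P phi|)); apply: cvgMr_tmp; exact: cvg_harmonic.
apply: (@squeeze_cvgr _ _ _ _ (cst 0) _ _ _ _ _ c0); last exact: cvg_cst.
by apply: nearW => n; rewrite normr_ge0 cesaro_almost_invariant.
Qed.

Lemma cesaro_equivZD phi a b f g : a + b = 1 -> cesaro_equiv phi f ->
  cesaro_equiv phi g -> cesaro_equiv phi (a *: f + b *: g).
Proof.
move=> ab1 fe ge; rewrite /cesaro_equiv.
have -> : (fun n => cesaro_mean P n.+1 (a *: f + b *: g) - cesaro_mean P n.+1 phi) =
  (fun n => a *: (cesaro_mean P n.+1 f - cesaro_mean P n.+1 phi) +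
            b *: (cesaro_mean P n.+1 g - cesaro_mean P n.+1 phi)).
  apply/funext => n; rewrite !scalerBr addrACA -opprD -scalerDl ab1 scale1r.
  by rewrite (MarkovD (cesaro_Markov n)) !(MarkovZ (cesaro_Markov n)).
have := cvgD (@cvgZl_tmp _ _ _ _ _ a _ _ fe) (@cvgZl_tmp _ _ _ _ _ b _ _ ge).
rewrite !scaler0 addr0 => h.
exact: h.
Qed.

Lemma cesaro_equiv_cesaro phi n : cesaro_equiv phi (cesaro_mean P n.+1 phi).
Proof.
rewrite /cesaro_equiv.
have -> : (fun k => cesaro_mean P k.+1 (cesaro_mean P n.+1 phi) - cesaro_mean P k.+1 phi) =
  (fun k => n.+1%:R^-1 *: \sum_(i < n.+1)
    (cesaro_mean P k.+1 (iter i P phi) - cesaro_mean P k.+1 phi)).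
  apply/funext => k; rewrite sumrB scalerBr sumr_const card_ord -[cesaro_mean P k.+1 phi *+ _]scaler_nat.
  rewrite scalerA mulVf ?scale1r ?pnatr_eq0//; congr (_ - _).
  by rewrite {2}/cesaro_mean (MarkovZ (cesaro_Markov k)) (Markov_sum (cesaro_Markov k)).
suff S0 : \sum_(i < n.+1) (cesaro_mean P k.+1 (iter i P phi) -
    cesaro_mean P k.+1 phi) @[k --> \oo] --> (0 : L1 m).
  by have := @cvgZl_tmp _ _ _ _ _ n.+1%:R^-1 _ _ S0; rewrite scaler0; exact.
elim: (index_enum _) => [|i r ih].
  by under eq_fun do rewrite big_nil; exact: cvg_cst.
rewrite -[X in _ --> X](addr0 0); under eq_fun do rewrite big_cons.
by apply: cvgD => //; exact: cesaro_equiv_iter.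
Qed.

End Cesaro.

(** * Uniform integrability *)

Lemma limn_esup_lt (R : realType) (u : (\bar R)^nat) (a : \bar R) :
  (limn_esup u < a)%E -> exists N, forall n, (N <= n)%N -> (u n < a)%E.
Proof.
rewrite limn_esup_lim (cvg_lim _ (@cvg_esups_inf R u))// => ua.
have [_ [N _ <-] uNa] := ereal_inf_lt ua.
exists N => n Nn; apply: le_lt_trans uNa; apply: ereal_sup_ubound.
by exists n.
Qed.

Section uniform_integrability.
Context d (T : measurableType d) (R : realType) (m : probability T R).
Implicit Types (f g h : L1 m) (A E : set T).

Lemma int_restr_EFin A f : measurable A ->
  (intL (restr A f))%:E = (\int[m]_(x in A) (f x)%:E)%E.
Proof.
move=> mA; rewrite int_restr// fineK//; apply: integrable_fin_num => //.
exact: integrableS (L1_integrable f).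
Qed.

Definition eventually_small (f : nat -> L1 m) (kappa delta : R) : Prop :=
  forall E, measurable E -> (m E < delta%:E)%E ->
    exists N, forall n, (N <= n)%N -> intL (restr E (f n)) < kappa.

(** A gliding hump: if the tails above every level stayed large along some
    subsequence, then the union of rapidly smaller tail sets would be a single
    small set on which the f n do not become small. *)
Lemma eventually_uniform (f : nat -> L1 m) kappa delta : 0 < delta ->
  (forall n, densities (f n)) -> eventually_small f kappa delta ->
  exists K N, 0 <= K /\
    forall n, (N <= n)%N -> intL (posL (f n - K *: oneL m)) <= kappa.
Proof.
move=> d0 df sf; apply: contrapT => nK.
(* These levels give the tail sets a total measure of at most delta / 2. *)
pose K k : R := 2 ^+ k.+1 / (delta / 2).
have K0 k : 0 < K k by rewrite divr_gt0 ?exprn_gt0// divr_gt0.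
have /choice[n nP] k : exists n, (k <= n)%N /\ kappa < intL (posL (f n - K k *: oneL m)).
  apply: contrapT => nn; apply: nK; exists (K k), k; split; first exact: ltW.
  by move=> n kn; rewrite leNgt; apply/negP => ?; apply: nn; exists n.
pose E k := [set x | K k < f (n k) x].
have mE k : measurable (E k).
  by rewrite -[E k]setTI; apply: measurable_fun_ltr => //; exact: L1_measurable.
have muE k : (m (E k) <= ((delta / 2) / (2 ^ k.+1)%:R)%:E)%E.
  have -> : delta / 2 / (2 ^ k.+1)%:R = (K k)^-1.
    by rewrite /K invf_div natrX.
  rewrite -[leLHS]fineK ?fin_num_measure// lee_fin -int_restr_oneL//.
  rewrite -(ler_pM2l (K0 k)) mulfV ?gt_eqF// -intZ.
  have /densitiesP[f0 f1] := df (n k); rewrite -[leRHS]f1; apply: le_int; move/ge0LP in f0; near=> x.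
  rewrite (near (Lp_funZ (K k) (restr (E k) (oneL m))) x)//.
  rewrite (near (restrE (oneL m) (mE k)) x)// (near (oneLE m) x)// mul1r indicE.
  have [xE|xE] := boolP (x \in E k); last by rewrite mulr0; near: x.
  by rewrite mulr1 ltW//; move: xE; rewrite inE.
pose U := \bigcup_k E k.
have mU : measurable U by exact: bigcup_measurable.
have Ud : (m U < delta%:E)%E.
  apply: (@le_lt_trans _ _ (delta / 2)%:E); last by rewrite lte_fin ltr_pdivrMr// ltr_pMr// ltr1n.
  apply: le_trans (measure_sigma_subadditive _ mE mU (@subset_refl _ U)) _.
  have d20 : 0 <= delta / 2 by rewrite ltW// divr_gt0.
  apply: le_trans _ (@epsilon_trick0 R (delta / 2) xpredT d20).
  by apply: lee_nneseries => k *; [exact: measure_ge0|exact: muE].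
have [N NP] := sf U mU Ud.
have [Nn] := nP N; apply/negP; rewrite -leNgt (le_trans _ (ltW (NP _ Nn)))//.
have /densitiesP[/ge0LP f0 _] := df (n N).
apply: le_int; near=> x.
rewrite (near (posLE (f (n N) - K N *: oneL m)) x)//.
rewrite (near (L1_funB (f (n N)) (K N *: oneL m)) x)//.
rewrite (near (Lp_funZ (K N) (oneL m)) x)// (near (oneLE m) x)// mulr1.
rewrite (near (restrE (f (n N)) mU) x)//.
have fx0 : 0 <= f (n N) x by near: x.
rewrite ge_max mulr_ge0// andbT.
have [xU|xU] := boolP (x \in U); rewrite indicE ?xU ?(negbTE xU).
  by rewrite mulr1 lerBlDr lerDl ltW.
rewrite mulr0 subr_le0 leNgt; apply/negP => Kf.
by move/negP: xU; apply; rewrite inE; exists N.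
Unshelve. all: by end_near. Qed.

Variable P : L1 m -> L1 m.
Hypothesis MP : Markov P.

Definition cesaro_small kappa delta : Prop := forall phi, densities phi ->
  eventually_small (fun n => cesaro_mean P n.+1 phi) kappa delta.

Lemma AMC2_small : AMC2 P -> exists kappa delta,
  [/\ kappa < 1, 0 < delta & cesaro_small kappa delta].
Proof.
move=> [kappa [delta [k1 d0 H]]]; exists kappa, delta; split => // phi dphi E mE mEd.
have [N NP] := limn_esup_lt (H phi E dphi mE mEd).
exists N => n Nn; rewrite -lte_fin int_restr_EFin//; apply: NP.
by rewrite (leq_trans Nn).
Qed.

(** Cesaro means inherit eventual smallness: the finitely many terms before it
    sets in contribute at most N / (n + 1) to the average. *)
Lemma constrictive_small : asymptotically_constrictive P ->
  forall kappa, 0 < kappa -> exists2 delta, 0 < delta & cesaro_small kappa delta.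
Proof.
move=> H kappa k0; have e0 : 0 < kappa / 2 by rewrite divr_gt0.
have [delta d0 HE] := H _ e0; exists delta => // phi dphi E mE mEd.
have [N NP] := limn_esup_lt (HE phi E dphi mE mEd).
pose a i := intL (restr E (iter i P phi)).
have [phi0 phi1] := (densitiesP phi).1 dphi.
have a1 i : a i <= 1.
  rewrite -phi1 -(Markov_int (iter_Markov MP i) phi); apply/le_int/restr_le => //.
  exact: Markov_ge0 (iter_Markov MP i) _ phi0.
have aN i : (N <= i)%N -> a i <= kappa / 2.
  by move=> Ni; rewrite ltW// -lte_fin /a int_restr_EFin//; exact: NP.
pose M := Num.trunc (N%:R / (kappa / 2)).
exists M => n Mn.
have -> : restr E (cesaro_mean P n.+1 phi) =
    n.+1%:R^-1 *: \sum_(i < n.+1) restr E (iter i P phi).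
  rewrite /cesaro_mean restrZ//; congr (_ *: _).
  exact: restr_sum.
rewrite intZ int_sum mulrC ltr_pdivrMr//.
have aM k : \sum_(i < k) a i <= (minn k N)%:R + k%:R * (kappa / 2).
  elim: k => [|k ih]; first by rewrite big_ord0 min0n mul0r addr0.
  rewrite big_ord_recr/= -natr1 mulrDl mul1r.
  have [kN|Nk] := ltnP k N.
    rewrite (minn_idPl kN); rewrite (minn_idPl (ltnW kN)) in ih.
    by have := a1 k; rewrite -natr1; lra.
  rewrite (minn_idPr (leqW Nk)); rewrite (minn_idPr Nk) in ih.
  by have := aN k Nk; lra.
have {}aM := le_trans (aM n.+1) (lerD (_ : _ <= N%:R) (lexx _)).
apply: le_lt_trans (aM _) _; first by rewrite ler_nat geq_minr.
have : N%:R / (kappa / 2) < n.+1%:R.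
  by rewrite (lt_le_trans (truncnS_gt _))// ler_nat ltnS.
rewrite ltr_pdivrMr// => Nn; rewrite [ltRHS](_ : _ = n.+1%:R * (kappa / 2) + n.+1%:R * (kappa / 2)).
  by rewrite ltrD2r.
by rewrite -mulrDr -splitr mulrC.
Qed.

End uniform_integrability.

(** * Convergent selections from convex sets *)

Section L1_limits.
Context d (T : measurableType d) (R : realType) (m : probability T R).
Implicit Types (f g h G H : L1 m).

Lemma int_cvg (u : nat -> L1 m) l : u n @[n --> \oo] --> l ->
  intL (u n) @[n --> \oo] --> intL l.
Proof.
move=> ul; apply: (@functional_cvg _ _ _ _ (@intL _ _ _ m) 1) ul.
  by move=> a f g; rewrite intD intZ.
by move=> f; rewrite mul1r ler_norm_int.
Qed.

Lemma leL_cvg (u w : nat -> L1 m) l k : (forall n, u n [<=] w n) ->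
  u n @[n --> \oo] --> l -> w n @[n --> \oo] --> k -> l [<=] k.
Proof.
move=> uw ul wk; have p0 : posL (l - k) = 0.
  apply: int_eq0; first exact: posL_ge0.
  apply/eqP; rewrite eq_le int_ge0 ?andbT; last exact: posL_ge0.
  have c0 : `|l - u n| + `|w n - k| @[n --> \oo] --> (0 : R).
    rewrite -[X in _ --> X](addr0 0); apply: cvgD; apply/norm_cvg0P.
      by rewrite -(subrr l); apply: cvgB => //; exact: cvg_cst.
    exact/subr_cvg0.
  apply: (cvgr_to_ge c0); apply: nearW => n.
  rewrite -[l - k](_ : (l - u n) + (u n - w n) + (w n - k) = _); last first.
    by rewrite (addrA (l - u n)) subrK addrA subrK.
  rewrite (le_trans (int_posL_add _ _))// lerD ?int_posL_le_norm//.
  rewrite (le_trans (int_posL_add _ _))// -[leRHS]addr0 lerD ?int_posL_le_norm//.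
  rewrite -(int0 m); apply: le_int; apply: posL_le (leL_refl _).
  exact/subL_le0.
by apply/subL_le0; rewrite -p0; exact: le_posL.
Qed.

Definition boundedL (K : R) f : Prop := {ae m, forall x, `|f x| <= K}.

Definition sqL f : L1 m := toL1 m (fun x => f x ^+ 2).

Lemma sqLE K f : boundedL K f -> {ae m, forall x, sqL f x = f x ^+ 2}.
Proof.
move=> fK; apply: toL1E; apply: (@ae_integrable _ _ _ _ _ (cst (K ^+ 2))).
- by apply: measurable_funX; exact: L1_measurable.
- by apply: filterS fK => x fK; rewrite normrX lerXn2r// nnegrE (le_trans _ fK).
- exact: finite_measure_integrable_cst.
Qed.

Lemma parallelogram K f g : boundedL K f -> boundedL K g ->
  intL (sqL (f - g)) =
  2 * intL (sqL f) + 2 * intL (sqL g) - 4 * intL (sqL (2^-1 *: (f + g))).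
Proof.
move=> fK gK.
have fgE := L1_funB f g; have FE := Lp_funD f g.
have mE := Lp_funZ 2^-1 (f + g).
have bB : boundedL (K + K) (f - g).
  by apply: filterS3 fK gK fgE => x a b ->; rewrite (le_trans (ler_normB _ _))// lerD.
have bM : boundedL K (2^-1 *: (f + g)).
  apply: filterS3 (filterI fK gK) mE FE => x [a b] -> ->.
  rewrite normrM ger0_norm// mulrC ler_pdivrMr// (le_trans (ler_normD _ _))//.
  by rewrite mulr_natr mulr2n lerD.
rewrite -!intZ -intD -intB; congr intL; apply: L1P; near=> x.
rewrite (near (L1_funB (2 *: sqL f + 2 *: sqL g) (4 *: sqL (2^-1 *: (f + g)))) x)//.
rewrite (near (Lp_funD (2 *: sqL f) (2 *: sqL g)) x)//.
rewrite (near (Lp_funZ 2 (sqL f)) x)// (near (Lp_funZ 2 (sqL g)) x)//.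
rewrite (near (Lp_funZ 4 (sqL (2^-1 *: (f + g)))) x)//.
rewrite (near (sqLE bB) x)// (near (sqLE bM) x)// (near (sqLE fK) x)//.
rewrite (near (sqLE gK) x)// (near fgE x)// (near mE x)// (near FE x)//.
by field.
Unshelve. all: by end_near. Qed.

Lemma sqL_ge0 K f : boundedL K f -> 0 <= intL (sqL f).
Proof.
by move=> fK; apply/int_ge0/ge0LP; apply: filterS (sqLE fK) => x ->; rewrite sqr_ge0.
Qed.

Lemma sqL_le K f : 0 <= K -> boundedL K f -> intL (sqL f) <= K ^+ 2.
Proof.
move=> K0 fK; have -> : K ^+ 2 = intL (K ^+ 2 *: oneL m) by rewrite intZ int_oneL mulr1.
apply: le_int; near=> x.
rewrite (near (sqLE fK) x)// (near (Lp_funZ (K ^+ 2) (oneL m)) x)//.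
rewrite (near (oneLE m) x)// mulr1 -real_normK ?num_real// lerXn2r ?nnegrE//.
by near: x.
Unshelve. all: by end_near. Qed.

(** Pointwise |t| <= e + t^2 / e, so that smallness in L2 gives smallness in L1. *)
Lemma norm_le_sqL K f e : boundedL K f -> 0 < e -> `|f| <= e + intL (sqL f) / e.
Proof.
move=> fK e0.
have -> : e + intL (sqL f) / e = intL (e *: oneL m + e^-1 *: sqL f).
  by rewrite intD !intZ int_oneL mulr1 mulrC.
rewrite normLE -intD; apply: le_int; near=> x.
rewrite (near (Lp_funD (posL f) (posL (- f))) x)//.
rewrite (near (Lp_funD (e *: oneL m) (e^-1 *: sqL f)) x)//.
rewrite (near (Lp_funZ e (oneL m)) x)// (near (Lp_funZ e^-1 (sqL f)) x)//.
rewrite (near (oneLE m) x)// (near (sqLE fK) x)// mulr1.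
rewrite (near (posLE f) x)// (near (posLE (- f)) x)// (near (L1_funN f) x)//.
rewrite -(ler_pM2l e0) [leRHS]mulrDr mulrA mulfV ?gt_eqF// mul1r.
by case: (leP (f x) 0) => ?; case: (leP (- f x) 0) => ?; nra.
Unshelve. all: by end_near. Qed.

(** Near-minimizers of the L2 norm are Cauchy, by the parallelogram law and the
    lower bound on the norm of their midpoints. *)
Lemma convex_selection (C : nat -> set (L1 m)) K : 0 <= K ->
  (forall j, C j.+1 `<=` C j) -> (forall j, C j !=set0) ->
  (forall j f g, C j f -> C j g -> C j (2^-1 *: (f + g))) ->
  (forall f, C 0%N f -> boundedL K f) ->
  exists (G : nat -> L1 m) (l : L1 m),
    (forall j, C j (G j)) /\ G n @[n --> \oo] --> l.
Proof.
move=> K0 CS C0 Cm CK.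
have Cle i j : (i <= j)%N -> C j `<=` C i.
  elim: j => [|j ih]; first by rewrite leqn0 => /eqP->.
  by rewrite leq_eqVlt => /predU1P[->//|/ih ij f /CS/ij].
have CKj j f : C j f -> boundedL K f by move=> /(Cle 0%N j (leq0n _))/CK.
pose V j := [set intL (sqL f) | f in C j].
have V0 j : has_inf (V j).
  split; first by have [f Cf] := C0 j; exists (intL (sqL f)), f.
  by exists 0 => _ [f Cf <-]; exact/sqL_ge0/(CKj j).
pose D j := inf (V j).
have DV j f : C j f -> D j <= intL (sqL f).
  by move=> Cf; apply: ge_inf; [case: (V0 j)|exists f].
have DS : {homo D : i j / (i <= j)%N >-> i <= j}.
  move=> i j ij; apply: lb_le_inf; first by case: (V0 j).
  by move=> _ [f Cf <-]; apply: DV; exact: Cle Cf.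
have DK j : D j <= K ^+ 2.
  by have [f Cf] := C0 j; rewrite (le_trans (DV j f Cf))// sqL_le//; exact: CKj Cf.
have /choice[G GP] j : exists G, C j G /\ intL (sqL G) < D j + j.+1%:R^-1.
  have [_ [G CG <-] GD] := @inf_adherent _ (V j) j.+1%:R^-1 ltac:(by rewrite invr_gt0) (V0 j).
  by exists G.
exists G.
suff [l Gl] : exists l : L1 m, G n @[n --> \oo] --> l by exists l; split => // j; case: (GP j).
apply: L1_complete => e e0.
have cD : cvgn D by apply: nondecreasing_is_cvgn => //; exists (K ^+ 2) => _ [j _ <-].
have DL j : D j <= limn D by exact: nondecreasing_cvgn_le.
(* The parallelogram law gives 8 eta, and [norm_le_sqL] needs (e / 2) ^+ 2. *)
pose eta := (e / 2) ^+ 2 / 8.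
have eta0 : 0 < eta by rewrite divr_gt0// exprn_gt0// divr_gt0.
move/cvgrPdist_le : (cD) => /(_ _ eta0)[N1 _ HN1].
have := @cvg_harmonic R => /cvgrPdist_le/(_ _ eta0)[N2 _ HN2].
exists (maxn N1 N2) => i j.
set N := maxn N1 N2 => Ni Nj.
have := HN1 N (leq_maxl _ _); rewrite /= ger0_norm ?subr_ge0// => H1.
have := HN2 N (leq_maxr _ _); rewrite /= sub0r normrN ger0_norm ?invr_ge0// => H2.
have GN k : (N <= k)%N -> C N (G k) /\ intL (sqL (G k)) <= limn D + eta.
  move=> Nk; have [CG GD] := GP k; split; first exact: Cle CG.
  rewrite (le_trans (ltW GD))// lerD// (le_trans _ H2)// /harmonic lef_pV2 ?posrE//.
  by rewrite ler_nat ltnS.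
have [Ci Gi] := GN _ Ni; have [Cj Gj] := GN _ Nj.
have bi := CKj _ _ Ci; have bj := CKj _ _ Cj.
have bB : boundedL (K + K) (G i - G j).
  by apply: filterS3 bi bj (L1_funB (G i) (G j)) => x a b ->;
    rewrite (le_trans (ler_normB _ _))// lerD.
have e20 : 0 < e / 2 by rewrite divr_gt0.
rewrite (le_trans (norm_le_sqL bB e20))// {3}(splitr e) lerD2l ler_pdivrMr//.
rewrite (parallelogram bi bj); have := DV _ _ (Cm _ _ _ Ci Cj).
have -> : e / 2 * (e / 2) = 8 * eta by rewrite /eta; field.
by move: Gi Gj H1; lra.
Unshelve. all: by end_near. Qed.

End L1_limits.

(** * Invariant functions below the Cesaro means *)

Lemma max_sub_le (R : realDomainType) (a b c : R) :
  Num.max (a + Num.max (b - a) 0 - c) 0 <= Num.max (a - c) 0 + Num.max (b - c) 0.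
Proof.
have [ac a0] : a - c <= Num.max (a - c) 0 /\ 0 <= Num.max (a - c) 0.
  by rewrite !le_max !lexx orbT.
have [bc b0] : b - c <= Num.max (b - c) 0 /\ 0 <= Num.max (b - c) 0.
  by rewrite !le_max !lexx orbT.
by rewrite ge_max; apply/andP; split; case: (leP (b - a) 0) => ?; lra.
Qed.

Section invariant_below.
Context d (T : measurableType d) (R : realType) (m : probability T R).
Variables (P : L1 m -> L1 m) (MP : Markov P) (phi : L1 m).
Implicit Types (f g h F G : L1 m).

(** A property strong enough to bound the integral by 1, yet preserved by limits
    and by f |-> max f (P f): iterating the latter makes such an f invariant
    without losing its relation to phi. *)
Definition below_means f : Prop := forall e, 0 < e -> exists F,
  [/\ densities F, cesaro_equiv P phi F, `|P F - F| <= e &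
      intL (posL (f - F)) <= e].

Lemma below_means_int f : below_means f -> intL f <= 1.
Proof.
move=> bf; apply/ler_addgt0Pr => e e0; have [F [/densitiesP[_ F1] _ _ Fe]] := bf e e0.
have := le_int (le_posL (f - F)); rewrite intB F1; lra.
Qed.

(** This is the pointwise maximum of f and P f. *)
Definition push f : L1 m := f + posL (P f - f).

Lemma le_push f : f [<=] push f.
Proof. by rewrite -{1}[f]addr0; apply: leLD (leL_refl f) (posL_ge0 _). Qed.

Lemma Markov_le_push f : P f [<=] push f.
Proof. by rewrite -{1}(subrKC f (P f)); apply: leLD (leL_refl f) (le_posL _). Qed.

Lemma below_means_push f : below_means f -> below_means (push f).
Proof.
move=> bf e e0; have e30 : 0 < e / 3 by rewrite divr_gt0.
have [F [dF cF PF fF]] := bf _ e30; exists F; split => //; first by lra.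
have le1 : posL (push f - F) [<=] posL (f - F) + posL (P f - F).
  near=> x.
  rewrite (near (posLE (push f - F)) x)// (near (L1_funB (push f) F) x)//.
  rewrite (near (Lp_funD f (posL (P f - f))) x)// (near (posLE (P f - f)) x)//.
  rewrite (near (L1_funB (P f) f) x)//.
  rewrite (near (Lp_funD (posL (f - F)) (posL (P f - F))) x)//.
  rewrite (near (posLE (f - F)) x)// (near (posLE (P f - F)) x)//.
  rewrite (near (L1_funB (P f) F) x)// (near (L1_funB f F) x)//.
  exact: max_sub_le.
have le2 : intL (posL (P f - F)) <= e / 3 + e / 3.
  rewrite -(subrK (P F) (P f)) -addrA (le_trans (int_posL_add _ _))// lerD//.
    by rewrite -(MarkovB MP) (le_trans (Markov_posL MP _)).
  exact: le_trans (int_posL_le_norm _) PF.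
rewrite (le_trans (le_int le1))// intD; lra.
Unshelve. all: by end_near. Qed.

Lemma below_means_cvg (u : nat -> L1 m) l : (forall n, below_means (u n)) ->
  u n @[n --> \oo] --> l -> below_means l.
Proof.
move=> bu /cvgrPdist_le ul e e0; have e20 : 0 < e / 2 by rewrite divr_gt0.
have [N _ /(_ N (leqnn N)) uN] := ul _ e20.
have [F [dF cF PF fF]] := bu N _ e20; exists F; split => //; first by lra.
rewrite -(subrK (u N) l) -addrA (le_trans (int_posL_add _ _))//.
by have := le_trans (int_posL_le_norm _) uN; lra.
Qed.

(** Iterating f |-> max f (P f) gives a monotone sequence whose integrals stay
    at most 1; at its limit P f <= f, and equality follows by integration. *)
Lemma below_means_invariant g : 0 [<=] g -> below_means g ->
  exists f, [/\ g [<=] f, P f = f & below_means f].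
Proof.
move=> g0 bg; pose v n := iter n push g.
have bv n : below_means (v n) by elim: n => // n; exact: below_means_push.
have vle i j : (i <= j)%N -> v i [<=] v j.
  elim: j => [|j ih]; first by rewrite leqn0 => /eqP->; exact: leL_refl.
  rewrite leq_eqVlt => /predU1P[->|/ih ij]; first exact: leL_refl.
  exact: leL_trans ij (le_push _).
have cI : cvgn (fun n => intL (v n)).
  apply: nondecreasing_is_cvgn; first by move=> i j /vle; exact: le_int.
  by exists 1 => _ [n _ <-]; exact: below_means_int.
have [f vf] : exists f : L1 m, v n @[n --> \oo] --> f.
  apply: L1_complete => e e0; have e20 : 0 < e / 2 by rewrite divr_gt0.
  move/cvgrPdist_le : (cI) => /(_ _ e20)[N _ HN]; exists N => i j Ni Nj.
  have := HN i Ni; have := HN j Nj; rewrite /= !ler_norml.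
  move=> /andP[? ?] /andP[? ?].
  have [ij|/ltnW ji] := leqP i j.
    rewrite distrC normL_ge0 ?intB; last exact/subL_ge0/vle.
    by lra.
  rewrite normL_ge0 ?intB; last exact/subL_ge0/vle.
  by lra.
exists f.
have vS : v n.+1 @[n --> \oo] --> f by rewrite (cvg_shiftS v).
split; last exact: below_means_cvg vf.
  by apply: (leL_cvg _ (cvg_cst g) vf) => n; exact: (vle 0%N n).
apply: leL_int_eq; last by rewrite Markov_int.
apply: (@leL_cvg _ _ _ _ (fun n => P (v n)) (fun n => v n.+1)) vS => [n|].
  exact: Markov_le_push.
exact: Markov_cvg.
Qed.

Variables (kappa delta : R).
Hypotheses (delta0 : 0 < delta) (small : cesaro_small P kappa delta).

(** F is a Cesaro mean of large index and G its truncation min F K at the level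
    K of [eventually_uniform]. *)
Lemma truncated_means : densities phi -> exists K N, 0 <= K /\
  forall n, (N <= n)%N -> exists F G,
    [/\ densities F, cesaro_equiv P phi F, `|P F - F| <= n.+1%:R^-1 &
     [/\ 0 [<=] G, G [<=] F, G [<=] K *: oneL m & 1 - kappa <= intL G]].
Proof.
move=> dphi.
have dA n : densities (cesaro_mean P n.+1 phi).
  exact: (Markov_density (cesaro_Markov MP n)).
have [K [N [K0 HK]]] := eventually_uniform delta0 dA (small dphi).
exists K, N; split => // n Nn.
(* The factor 2 absorbs the one in [cesaro_almost_invariant]. *)
pose k := (2 * n.+1)%N; pose F := cesaro_mean P k.+1 phi.
exists F, (F - posL (F - K *: oneL m)).
have /densitiesP[F0 F1] := dA k.
have GE : {ae m, forall x, Lp_fun (F - posL (F - K *: oneL m)) x = Num.min (F x) K}.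
  near=> x.
  rewrite (near (L1_funB F (posL (F - K *: oneL m))) x)//.
  rewrite (near (posLE (F - K *: oneL m)) x)//.
  rewrite (near (L1_funB F (K *: oneL m)) x)//.
  rewrite (near (Lp_funZ K (oneL m)) x)// (near (oneLE m) x)// mulr1.
  by rewrite /Num.max /Num.min; do 2!case: ifPn; rewrite -?leNgt; lra.
split.
- exact: dA.
- exact: (cesaro_equiv_cesaro MP).
- rewrite (le_trans (cesaro_almost_invariant MP k phi))//.
  rewrite normL_ge0; last by case/densitiesP : dphi.
  have /densitiesP[_ ->] := dphi; rewrite mulr1.
  rewrite mulrC ler_pdivrMr// ler_pdivlMl// -natrM ler_nat /k.
  by rewrite mulnC leqnSn.
- split.
- apply/ge0LP; move/ge0LP in F0; apply: filterS2 GE F0 => x -> F0.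
  by rewrite le_min F0.
- by apply: filterS GE => x ->; rewrite ge_min lexx.
- near=> x; rewrite (near GE x)// (near (Lp_funZ K (oneL m)) x)//.
  by rewrite (near (oneLE m) x)// mulr1 ge_min lexx orbT.
- rewrite intB F1 lerD2l lerNl opprK; apply: HK; rewrite (leq_trans Nn)// /k.
  by rewrite mul2n -addnn (leq_trans (leqnSn _))// leq_addr.
Unshelve. all: by end_near. Qed.

(** The functions below some density of the kind in [truncated_means] form the
    convex sets of [convex_selection]; a limit of selected functions keeps the
    mass 1 - kappa, and [below_means_invariant] enlarges it to an invariant
    function. *)
Lemma invariant_below : densities phi -> exists f,
  [/\ 0 [<=] f, P f = f, 1 - kappa <= intL f & below_means f].
Proof.
move=> dphi; have [K [N [K0 KN]]] := truncated_means dphi.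
pose C j : set (L1 m) := [set G | 0 [<=] G /\ exists F,
  [/\ densities F, cesaro_equiv P phi F, `|P F - F| <= (N + j).+1%:R^-1 &
     [/\ G [<=] F, G [<=] K *: oneL m & 1 - kappa <= intL G]]].
have [|||||G [g [CG Gg]]] := @convex_selection _ _ _ m C K.
- by [].
- move=> j G [G0 [F [dF cF PF GF]]]; split => //; exists F; split => //.
  by rewrite (le_trans PF)// lef_pV2 ?posrE// ler_nat addnS.
- move=> j; have [F [G [dF cF PF [G0 GF GK Gk]]]] := KN (N + j)%N (leq_addr _ _).
  by exists G; split => //; exists F.
- move=> j G G' [G0 [F [dF cF PF [GF GK Gk]]]] [G'0 [F' [dF' cF' PF' [GF' GK' Gk']]]].
  have h0 : 0 <= 2^-1 :> R by [].
  have half u : u = 2^-1 *: (u + u) :> L1 m.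
    by rewrite -[u + u]mulr2n -[u *+ 2]scaler_nat scalerA mulVf ?scale1r// pnatr_eq0.
  have mid u v u' v' : u [<=] v -> u' [<=] v' -> 2^-1 *: (u + u') [<=] 2^-1 *: (v + v').
    by move=> uv uv'; apply: leLZ => //; exact: leLD.
  have [F0 F1] := (densitiesP F).1 dF; have [F'0 F'1] := (densitiesP F').1 dF'.
  split; first by rewrite (half 0); exact: mid.
  exists (2^-1 *: (F + F')); split.
  + apply/densitiesP; split; first by rewrite (half 0); exact: mid.
    by rewrite intZ intD F1 F'1 -[1 + 1]/2%:R mulVf// pnatr_eq0.
  + by rewrite scalerDr; apply: cesaro_equivZD => //; rewrite [RHS](splitr 1) mul1r.
  + rewrite (MarkovZ MP) (MarkovD MP) -scalerBr opprD addrACA normrZ ger0_norm//.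
    by rewrite ler_pdivrMl// (le_trans (ler_normD _ _))// mulr_natl mulr2n lerD.
  + split; [exact: mid|by rewrite (half (K *: _)); exact: mid|].
    by rewrite intZ intD ler_pdivlMl// mulr_natl mulr2n lerD.
- move=> G [G0 [F [_ _ _ [_ GK _]]]]; move/ge0LP in G0; near=> x.
  rewrite ger0_norm; last by near: x.
  have : G x <= Lp_fun (K *: oneL m) x by near: x.
  by rewrite (near (Lp_funZ K (oneL m)) x)// (near (oneLE m) x)// mulr1.
have g0 : 0 [<=] g.
  by apply: (leL_cvg _ (cvg_cst 0) Gg) => n; case: (CG n).
have gk : 1 - kappa <= intL g.
  apply: (cvgr_to_ge (int_cvg Gg)); apply: nearW => n.
  by case: (CG n) => _ [F [_ _ _ [_ _]]].
have bg : below_means g.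
  move=> e e0; have e20 : 0 < e / 2 by rewrite divr_gt0.
  move/cvgrPdist_le : Gg => /(_ _ e20)[N1 _ HN1].
  have := @cvg_harmonic R => /cvgrPdist_le/(_ _ e0)[N2 _ HN2].
  pose j := maxn N1 N2.
  have := HN1 j (leq_maxl _ _) => /= gG.
  have := HN2 j (leq_maxr _ _); rewrite /= sub0r normrN ger0_norm ?invr_ge0// => je.
  have [G0 [F [dF cF PF [GF _ _]]]] := CG j.
  exists F; split => //.
    rewrite (le_trans PF)// (le_trans _ je)// /harmonic lef_pV2 ?posrE//.
    by rewrite ler_nat ltnS leq_addl.
  rewrite -(subrK (G j) g) -addrA (le_trans (int_posL_add _ _))//.
  rewrite (_ : posL (G j - F) = 0) ?int0 ?addr0.
    rewrite (le_trans (le_trans (int_posL_le_norm _) gG))//.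
    by rewrite ler_pdivrMr// ler_pMr// ler1n.
  apply: leL_anti (posL_ge0 _); apply: posL_le (leL_refl _); exact/subL_le0.
have [f [gf Pf bf]] := below_means_invariant g0 bg.
exists f; split => //; first exact: leL_trans gf.
exact: le_trans (le_int gf).
Unshelve. all: by end_near. Qed.

End invariant_below.

(** * Ergodic decomposition *)

Section ergodic_decomposition.
Context d (T : measurableType d) (R : realType) (m : probability T R).
Variables (P : L1 m -> L1 m) (MP : Markov P).
Implicit Types (f g h w : L1 m) (A : set T).

Definition disjL f g : Prop := {ae m, forall x, f x = 0 \/ g x = 0}.

Definition vanishes_with f g : Prop := {ae m, forall x, g x = 0 -> f x = 0}.

Lemma disjL_sym f g : disjL f g -> disjL g f.
Proof. by apply: filterS => x []; [right|left]. Qed.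

Lemma disjL_vanish f f' g : vanishes_with f' f -> disjL f g -> disjL f' g.
Proof. by apply: filterS2 => x ff [/ff|]; [left|right]. Qed.

Lemma disjL_supp f g : disjL f g -> m (supp f `&` supp g) = 0%E.
Proof.
move=> [N [mN N0 sN]]; apply: (@subset_measure0 _ _ _ m _ N) => //.
  by apply: measurableI; exact: measurable_supp.
by move=> x [/eqP fx /eqP gx]; apply: sN => -[].
Qed.

Lemma vanishes_restr A f g : measurable A -> vanishes_with f g ->
  vanishes_with (restr A f) g.
Proof.
by move=> mA; apply: filterS2 (restrE f mA) => x -> fg /fg ->; rewrite mul0r.
Qed.

Lemma vanishes_restr_supp f g : vanishes_with (restr (supp g) f) g.
Proof.
apply: filterS (restrE f (measurable_supp g)) => x -> gx0.
by rewrite indicE memNset ?mulr0//= /supp/= gx0 eqxx.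
Qed.

Lemma vanishes_refl f : vanishes_with f f.
Proof. exact: aeW. Qed.

Lemma vanishesZ a f g : vanishes_with f g -> vanishes_with (a *: f) g.
Proof. by apply: filterS2 (Lp_funZ a f) => x -> fg /fg ->; rewrite mulr0. Qed.

Lemma vanishesB f f' g : vanishes_with f g -> vanishes_with f' g ->
  vanishes_with (f - f') g.
Proof.
by apply: filterS3 (L1_funB f f') => x -> fg f'g gx; rewrite fg// f'g// subr0.
Qed.

Lemma vanishes_posL f g : vanishes_with f g -> vanishes_with (posL f) g.
Proof. by apply: filterS2 (posLE f) => x -> fg /fg ->; rewrite maxxx. Qed.

Lemma vanishesN f g : vanishes_with f g -> vanishes_with (- f) g.
Proof. by rewrite -scaleN1r; exact: vanishesZ. Qed.

Lemma invariant_normalize f : 0 [<=] f -> P f = f -> f <> 0 ->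
  invariant_density P ((intL f)^-1 *: f).
Proof.
move=> f0 Pf fn0; have i0 : intL f != 0 by apply/eqP => /(int_eq0 f0).
split; last by rewrite (MarkovZ MP) Pf.
apply/densitiesP; split; last by rewrite intZ mulVf.
by apply: geL0Z => //; rewrite invr_ge0 int_ge0.
Qed.

Definition disjoint_family r (h : 'I_r -> L1 m) : Prop :=
  (forall i, invariant_density P (h i)) /\
  (forall i j, i != j -> disjL (h i) (h j)).

Lemma family_ge0 r (h : 'I_r -> L1 m) i : disjoint_family h -> 0 [<=] h i.
Proof. by move=> [/(_ i)[/densitiesP[]]]. Qed.

Lemma family_int r (h : 'I_r -> L1 m) i : disjoint_family h -> intL (h i) = 1.
Proof. by move=> [/(_ i)[/densitiesP[]]]. Qed.

Lemma family_inv r (h : 'I_r -> L1 m) i : disjoint_family h -> P (h i) = h i.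
Proof. by move=> [/(_ i)[]]. Qed.

Lemma family_disjoint r (h : 'I_r -> L1 m) : disjoint_family h ->
  {ae m, forall x, forall i j, i != j -> h i x = 0 \/ h j x = 0}.
Proof.
move=> [_ hD]; apply: filter_forall => i; apply: filter_forall => j.
have [->|ij] := eqVneq i j; first by apply: aeW => x /eqP.
by apply: filterS (hD i j ij).
Qed.

Lemma extend_family r (h : 'I_r -> L1 m) f : disjoint_family h ->
  0 [<=] f -> P f = f -> f <> 0 -> (forall i, disjL f (h i)) ->
  exists h' : 'I_r.+1 -> L1 m, disjoint_family h'.
Proof.
move=> [hI hD] f0 Pf fn0 fh.
pose f' := (intL f)^-1 *: f.
have f'h i : disjL f' (h i).
  by apply: disjL_vanish (fh i); apply: vanishesZ; exact: vanishes_refl.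
exists (fun i => if unlift ord0 i is Some j then h j else f'); split=> [i|i j].
  by case: unliftP => [j _|_]; [exact: hI|exact: invariant_normalize].
case: unliftP => [i' ->|->]; case: unliftP => [j' ->|->] ij //.
- by apply: hD; apply: contra ij => /eqP ->.
- exact/disjL_sym/f'h.
Qed.

Lemma replace_family r (h : 'I_r -> L1 m) i w : disjoint_family h ->
  invariant_density P w -> vanishes_with w (h i) ->
  disjoint_family (fun j => if j == i then w else h j).
Proof.
move=> [hI hD] wI wh; split=> [j|j k jk]; first by case: ifP.
case: (eqVneq j i) => [ji|_]; case: (eqVneq k i) => [ki|_]; last exact: hD.
- by rewrite ji ki eqxx in jk.
- by apply: disjL_vanish wh _; apply: hD; rewrite -ji.
- by apply/disjL_sym/(disjL_vanish wh)/hD; rewrite -ki eq_sym.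
Qed.

Section maximal_family.
Variables (r : nat) (h : 'I_r -> L1 m).
Hypothesis hF : disjoint_family h.
Hypothesis hmax : forall h' : 'I_r.+1 -> L1 m, ~ disjoint_family h'.

Lemma maximal_disjoint0 f : 0 [<=] f -> P f = f -> (forall i, disjL f (h i)) ->
  f = 0.
Proof.
move=> f0 Pf fh; apply: contrapT => fn0.
by have [h' /hmax] := extend_family hF f0 Pf fn0 fh.
Qed.

(** Otherwise h i could be replaced by the normalizations of w and w', which
    would make the family longer. *)
Lemma maximal_split i w w' : 0 [<=] w -> P w = w -> 0 [<=] w' -> P w' = w' ->
  vanishes_with w (h i) -> vanishes_with w' (h i) -> disjL w w' ->
  w = 0 \/ w' = 0.
Proof.
move=> w0 Pw w'0 Pw' wh w'h ww'; have [|wn0] := pselect (w = 0); first by left.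
right; apply: contrapT => w'n0.
suff w'd j : disjL w' (if j == i then (intL w)^-1 *: w else h j).
  by have [h' /hmax] := extend_family (replace_family hF
    (invariant_normalize w0 Pw wn0) (vanishesZ _ wh)) w'0 Pw' w'n0 w'd.
case: eqVneq => [_|ji].
  by apply/disjL_sym/(disjL_vanish _ ww')/vanishesZ/vanishes_refl.
by apply: disjL_vanish w'h _; case: hF => _; apply; rewrite eq_sym.
Qed.

(** An absorbing set splits h i into two disjoint invariant parts. *)
Lemma maximal_ergodic i : ergodic P (h i).
Proof.
move=> A mA /(adjoint_absorbing MP mA) abA.
have h0 := family_ge0 i hF; have Ph := family_inv i hF.
have PA := restr_invariant MP mA abA h0 Ph.
have PC : P (restr (~` A) (h i)) = restr (~` A) (h i).
  by rewrite restrC// (MarkovB MP) PA Ph.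
have [|||AC|C0] := @maximal_split i (restr A (h i)) (restr (~` A) (h i))
    (restr_ge0 mA h0) PA (restr_ge0 (measurableC mA) h0) PC.
- by apply: vanishes_restr => //; exact: vanishes_refl.
- by apply: vanishes_restr; [exact: measurableC|exact: vanishes_refl].
- apply: filterS2 (restrE (h i) mA) (restrE (h i) (measurableC mA)) => x -> ->.
  by rewrite !indicE in_setC; case: (_ \in _); [right|left]; rewrite mulr0.
- by left; rewrite -int_restr// AC int0.
- right; rewrite -int_restr//; move: C0; rewrite restrC// => /subr0_eq <-.
  exact: family_int.
Qed.

Definition family_mean : L1 m := r%:R^-1 *: \sum_(i < r) h i.

Lemma family_mean_ge0 : 0 [<=] family_mean.
Proof. by apply: geL0Z => //; apply: sumL_ge0 => i; exact: family_ge0. Qed.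

Lemma family_mean_inv : P family_mean = family_mean.
Proof.
rewrite /family_mean (MarkovZ MP) (Markov_sum MP); congr (_ *: _).
by apply: eq_bigr => i _; exact: family_inv.
Qed.

Lemma vanishes_family_mean i : vanishes_with (h i) family_mean.
Proof.
have r0 : (0 < r)%N by exact: leq_ltn_trans (ltn_ord i).
have h0 : {ae m, forall x, forall j, 0 <= h j x}.
  by apply: filter_forall => j; exact/ge0LP/family_ge0.
apply: filterS3 h0 (Lp_funZ r%:R^-1 (\sum_(i < r) h i)) (@L1_fun_sum _ _ _ m _
  (index_enum 'I_r) h (fun j x => h j x) (fun i => aeW _ (fun x => erefl))).
move=> x h0 -> -> /eqP; rewrite mulf_eq0 invr_eq0 pnatr_eq0 gtn_eqF//=.
by rewrite psumr_eq0// => /allP/(_ i (mem_index_enum _))/eqP.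
Qed.

Let S := supp family_mean.

Lemma family_supp_absorbing : absorbing P S.
Proof. exact: (supp_absorbing MP family_mean_ge0 family_mean_inv). Qed.

(** The part of f outside S is invariant and disjoint from every h i. *)
Lemma invariant_supported f : 0 [<=] f -> P f = f -> restr S f = f.
Proof.
move=> f0 Pf; have mS : measurable S by exact: measurable_supp.
have PS := restr_invariant MP mS family_supp_absorbing f0 Pf.
apply/esym/subr0_eq; rewrite -restrC//; apply: maximal_disjoint0.
- by apply: restr_ge0 => //; exact: measurableC.
- by rewrite restrC// (MarkovB MP) Pf PS.
move=> i; apply: filterS2 (restrE f (measurableC mS)) (vanishes_family_mean i) => x -> hx.
rewrite indicE in_setC; have [xS|xS] := boolP (x \in S); first by left; rewrite mulr0.
by right; apply: hx; apply/eqP/negbNE; apply/negP; move/negP : xS; rewrite inE.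
Qed.

(** The two signed parts of the difference are invariant and disjoint, so one of
    them vanishes by [maximal_split]; as they have equal integrals, both do. *)
Lemma restr_family f i : 0 [<=] f -> P f = f ->
  restr (supp (h i)) f = intL (restr (supp (h i)) f) *: h i.
Proof.
move=> f0 Pf; have mS := measurable_supp (h i).
have h0 := family_ge0 i hF; have Ph := family_inv i hF.
set c := intL _; pose w := restr (supp (h i)) f - c *: h i.
have Pw : P w = w.
  rewrite /w (MarkovB MP) (MarkovZ MP) Ph; congr (_ - _).
  exact: (restr_invariant MP mS (supp_absorbing MP h0 Ph) f0 Pf).
have PNw : P (- w) = - w by rewrite (MarkovN MP) Pw.
have vw : vanishes_with w (h i).
  apply: vanishesB; first exact: vanishes_restr_supp.
  by apply: vanishesZ; exact: vanishes_refl.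
have w0 : intL w = 0 by rewrite intB intZ (family_int i hF) mulr1 subrr.
have : intL (posL w) = intL (posL (- w)).
  by apply/eqP; rewrite -subr_eq0 -intB posL_sub w0.
have := @maximal_split i _ _ (posL_ge0 w) (posL_invariant MP Pw) (posL_ge0 (- w))
  (posL_invariant MP PNw) (vanishes_posL vw) (vanishes_posL (vanishesN vw)) (posL_disj w).
have norm0 : intL (posL w) = 0 -> intL (posL (- w)) = 0 -> w = 0.
  by move=> p0 n0; apply: normr0_eq0; rewrite normLE p0 n0 addr0.
case=> p0 pE; apply: subr0_eq; apply: norm0.
- by rewrite p0 int0.
- by rewrite -pE p0 int0.
- by rewrite pE p0 int0.
- by rewrite p0 int0.
Qed.

(** On supp (h i) the function is a multiple of h i, and it vanishes off all the
    supports. *)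
Lemma invariant_combination f : 0 [<=] f -> P f = f ->
  f = \sum_(i < r) intL (restr (supp (h i)) f) *: h i.
Proof.
move=> f0 Pf; pose c i := intL (restr (supp (h i)) f).
have mS : measurable S by exact: measurable_supp.
have sumE : {ae m, forall x, Lp_fun (\sum_(i < r) c i *: h i) x =
    \sum_(i < r) c i * h i x}.
  by apply: L1_fun_sum => i; exact: Lp_funZ.
have rE : {ae m, forall x, forall i, f x * \1_(supp (h i)) x = c i * h i x}.
  apply: filter_forall => i.
  have := restrE f (measurable_supp (h i)); rewrite restr_family//.
  by apply: filterS2 (Lp_funZ (c i) (h i)) => x ->.
have fS : {ae m, forall x, f x = f x * \1_S x}.
  by have := restrE f mS; rewrite invariant_supported.
have mE : {ae m, forall x, family_mean x = r%:R^-1 * \sum_(i < r) h i x}.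
  apply: filterS2 (Lp_funZ r%:R^-1 (\sum_(i < r) h i)) (@L1_fun_sum _ _ _ m _
    (index_enum 'I_r) h (fun j x => h j x) (fun i => aeW _ (fun x => erefl))).
  by move=> x -> ->.
apply: L1P; apply: filterS3 (filterI sumE rE) (filterI fS mE) (family_disjoint hF).
move=> x [-> fx] [fSx mx] hDx.
have [[i hi]|nh] := pselect (exists i, h i x != 0).
  rewrite (bigD1 i)//= big1 ?addr0 => [|j ji].
    by rewrite -fx indicE mem_set// mulr1.
  have [->|h0] := hDx j i ji; first by rewrite mulr0.
  by rewrite h0 eqxx in hi.
have h0 i : h i x = 0 by apply/eqP/negbNE/negP => hi; apply: nh; exists i.
rewrite big1 => [|i _]; last by rewrite h0 mulr0.
rewrite fSx indicE memNset ?mulr0// /S /supp/= mx.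
by rewrite big1 ?mulr0 ?eqxx.
Qed.

End maximal_family.
End ergodic_decomposition.

(** * Maximal families and maximal support *)

Lemma sumr_bounds (R : numDomainType) n (a : 'I_n -> R) lo hi :
  (forall i, lo <= a i <= hi) -> n%:R * lo <= \sum_(i < n) a i <= n%:R * hi.
Proof.
move=> ab; have cE (c : R) : n%:R * c = \sum_(i < n) c.
  by rewrite sumr_const card_ord mulr_natl.
rewrite (cE lo) (cE hi); by apply/andP; split; apply: ler_sum => i _; case/andP: (ab i).
Qed.

Section small_means.
Context d (T : measurableType d) (R : realType) (m : probability T R).
Variables (P : L1 m -> L1 m) (MP : Markov P) (kappa delta : R).
Hypotheses (kappa1 : kappa < 1) (delta0 : 0 < delta).
Hypothesis small : cesaro_small P kappa delta.
Implicit Types (f g h w phi : L1 m) (A : set T).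

Lemma oneL_density : densities (oneL m).
Proof. by apply/densitiesP; rewrite int_oneL; split => //; exact: oneL_ge0. Qed.

Lemma kappa_gt0 : 0 < kappa.
Proof.
have [|N /(_ N (leqnn N))] := small oneL_density measurable0.
  by rewrite measure0 lte_fin.
by rewrite int_restr// Rintegral_set0.
Qed.

(** The Cesaro means of an invariant density are constant, hence not small on
    its support. *)
Lemma supp_large h : invariant_density P h -> delta <= fine (m (supp h)).
Proof.
move=> [dh Ph]; have mS := measurable_supp h; rewrite leNgt; apply/negP => hd.
have [|N /(_ N (leqnn N))] := small dh mS.
  by rewrite -[ltLHS]fineK ?fin_num_measure// lte_fin.
rewrite cesaro_fix// restr_supp; have /densitiesP[_ ->] := dh.
by rewrite ltNge ltW.
Qed.

(** The supports are disjoint and each has measure at least delta. *)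
Lemma family_bound r (h : 'I_r -> L1 m) : disjoint_family P h -> r%:R * delta <= 1.
Proof.
move=> hF; pose s i := restr (supp (h i)) (oneL m).
have : intL (\sum_(i < r) s i) <= intL (oneL m).
  apply: le_int.
  have sE : {ae m, forall x, Lp_fun (\sum_(i < r) s i) x = \sum_(i < r) \1_(supp (h i)) x}.
    apply: L1_fun_sum => i.
    apply: filterS2 (restrE (oneL m) (measurable_supp (h i))) (oneLE m) => x -> ->.
    by rewrite mul1r.
  apply: filterS3 sE (oneLE m) (family_disjoint hF) => x -> -> hx.
  have i0 j : h j x = 0 -> \1_(supp (h j)) x = 0 :> R.
    by move=> hj; rewrite indicE memNset// /supp/= hj eqxx.
  have [[i hi]|nh] := pselect (exists i, h i x != 0); last first.
    rewrite big1// => i _; apply: i0.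
    by apply/eqP/negbNE/negP => hi; apply: nh; exists i.
  rewrite (bigD1 i)//= big1 ?addr0 ?indicE ?mem_set// => j ji.
  by have [/i0//|h0] := hx j i ji; rewrite h0 eqxx in hi.
rewrite int_oneL int_sum; apply: le_trans.
rewrite -[r in leLHS]card_ord mulr_natl -sumr_const; apply: ler_sum => i _.
by rewrite int_restr_oneL ?supp_large//; [exact: hF.1|exact: measurable_supp].
Qed.

Lemma family1 : exists h : 'I_1 -> L1 m, disjoint_family P h.
Proof.
have [f [f0 Pf fk _]] := invariant_below MP delta0 small oneL_density.
have fn0 : f <> 0.
  by move=> fE; move: fk; rewrite fE int0 subr_le0 leNgt kappa1.
exists (fun=> (intL f)^-1 *: f); split => [_|i j]; last by rewrite !ord1 eqxx.
exact: invariant_normalize.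
Qed.

Lemma maximal_family_exists : exists r (h : 'I_r -> L1 m),
  [/\ (0 < r)%N, disjoint_family P h &
      forall h' : 'I_r.+1 -> L1 m, ~ disjoint_family P h'].
Proof.
pose Q r := `[< exists h : 'I_r -> L1 m, disjoint_family P h >].
have Q1 : exists r, Q r by exists 1%N; apply/asboolP; exact: family1.
have Qb r : Q r -> (r <= Num.trunc delta^-1)%N.
  move=> /asboolP[h /family_bound rd]; rewrite -ltnS -(ltr_nat R).
  apply: le_lt_trans (truncnS_gt _).
  by rewrite -[leRHS]div1r ler_pdivlMr.
case: (ex_maxnP Q1 Qb) => r /asboolP[h hF] rmax.
exists r, h; split => //.
  by apply: rmax; apply/asboolP; exact: family1.
move=> h' hF'; have /rmax : Q r.+1 by apply/asboolP; exists h'.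
by rewrite ltnn.
Qed.

Section maximal_support.
Variables (r : nat) (h : 'I_r -> L1 m).
Hypothesis hF : disjoint_family P h.
Hypothesis hmax : forall h' : 'I_r.+1 -> L1 m, ~ disjoint_family P h'.
Let S := supp (family_mean h).
Let mS : measurable S. Proof. exact: measurable_supp. Qed.
Let abS : absorbing P S. Proof. exact: family_supp_absorbing. Qed.

Lemma outside_le f : 0 [<=] f -> intL (restr (~` S) (P f)) <= intL (restr (~` S) f).
Proof. by move=> f0; rewrite !restrC// !intB Markov_int// lerD2l lerN2; exact: abS. Qed.

Lemma outside_iter_le f i n : (i <= n)%N -> 0 [<=] f ->
  intL (restr (~` S) (iter n P f)) <= intL (restr (~` S) (iter i P f)).
Proof.
move=> + f0; elim: n => [|n ih]; first by rewrite leqn0 => /eqP->.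
rewrite leq_eqVlt => /predU1P[->//|/ih]; apply: le_trans.
exact/outside_le/(Markov_ge0 (iter_Markov MP n)).
Qed.

Lemma outside_cesaro n f : 0 [<=] f ->
  intL (restr (~` S) (iter n P f)) <= intL (restr (~` S) (cesaro_mean P n.+1 f)) /\
  intL (restr (~` S) (cesaro_mean P n.+1 f)) <= intL (restr (~` S) f).
Proof.
move=> f0; rewrite /cesaro_mean restrZ; last exact: measurableC.
rewrite restr_sum; last exact: measurableC.
rewrite intZ int_sum ler_pdivlMl// ler_pdivrMl//.
apply/andP; apply: sumr_bounds => i.
apply/andP; split; first by apply: outside_iter_le; rewrite // -ltnS.
exact: (@outside_iter_le f 0 i).
Qed.

(** An invariant function of mass at least 1 - kappa is carried by S and lies, up
    to a small error, below a density F with the same asymptotic Cesaro means as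
    phi; hence F has little more than kappa outside S. As the mass outside S never
    increases under P, the same bound passes to the iterates of phi. *)
Lemma outside_density phi k' : densities phi -> kappa < k' ->
  exists n, intL (restr (~` S) (iter n P phi)) <= k'.
Proof.
move=> dphi kk'; have [f [f0 Pf fk bf]] := invariant_below MP delta0 small dphi.
pose e := (k' - kappa) / 2; have e0 : 0 < e by rewrite divr_gt0// subr_gt0.
have [F [dF cF _ fF]] := bf e e0; have [F0 F1] := (densitiesP F).1 dF.
have [phi0 phi1] := (densitiesP phi).1 dphi.
move/cvgrPdist_le : cF => /(_ e e0)[n _ /(_ n (leqnn n))].
rewrite sub0r normrN distrC; set A1 := cesaro_mean _ _ phi; set A2 := cesaro_mean _ _ F => AA.
exists n; apply: le_trans (outside_cesaro n phi0).1 _.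
have mC : measurable (~` S) by exact: measurableC.
have fS : restr S f = f by exact: invariant_supported hmax _ f0 Pf.
have outF : intL (restr (~` S) F) <= kappa + e.
  rewrite restrC// intB F1.
  have : f [<=] restr S F + posL (f - F).
    have fS' : {ae m, forall x, f x = f x * \1_S x} by have := restrE f mS; rewrite fS.
    near=> x; rewrite (near (Lp_funD (restr S F) (posL (f - F))) x)//.
    rewrite (near (restrE F mS) x)// (near (posLE (f - F)) x)//.
    rewrite (near (L1_funB f F) x)// (near fS' x)// indicE.
    case: (_ \in S); rewrite ?mulr1 ?mulr0 ?add0r ?le_max ?lexx ?orbT//.
    by rewrite -lerBlDl le_max lexx.
  move=> /le_int; rewrite intD => fSF.
  by move: fk fSF fF; lra.
have := (outside_cesaro n F0).2; rewrite -/A2 => A2F.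
have A12 : intL (restr (~` S) A1) <= intL (restr (~` S) A2) + e.
  rewrite -lerBlDl -intB -restrB//.
  apply: le_trans AA; apply: le_trans (int_posL_le_norm _); apply: le_int.
  apply: leL_trans (restr_mono mC (le_posL _)) _; apply: restr_le => //.
  exact: posL_ge0.
have eE : e + e = k' - kappa by rewrite -splitr.
apply: (le_trans A12); rewrite -(subrKC kappa k') -eE addrA lerD2r.
exact: le_trans A2F outF.
Unshelve. all: by end_near. Qed.

Lemma outside_contracts phi k' : 0 [<=] phi -> kappa < k' ->
  exists n, intL (restr (~` S) (iter n P phi)) <= k' * intL phi.
Proof.
move=> phi0 kk'; have [i0|i0] := eqVneq (intL phi) 0.
  exists 0%N; rewrite /= i0 mulr0 -i0; apply/le_int/restr_le => //.
  exact: measurableC.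
have ip : 0 < intL phi by rewrite lt_neqAle eq_sym i0 int_ge0.
have [|n] := @outside_density ((intL phi)^-1 *: phi) k' _ kk'.
  by apply/densitiesP; split; [apply: geL0Z; rewrite ?invr_ge0 ?int_ge0|rewrite intZ mulVf].
rewrite (MarkovZ (iter_Markov MP n)) restrZ; last exact: measurableC.
rewrite intZ ler_pdivrMl// mulrC => ?; by exists n.
Qed.

(** Restarting from the part of the mass still outside S, which is all that can
    be outside later, contributes a factor k' < 1 each time. *)
Lemma outside_cvg0 phi : 0 [<=] phi ->
  intL (restr (~` S) (iter n P phi)) @[n --> \oo] --> 0.
Proof.
move=> phi0; have mC : measurable (~` S) by exact: measurableC.
pose k' := (kappa + 1) / 2.
have kk' : kappa < k' by rewrite ltr_pdivlMr// mulr_natr mulr2n ltrD2l.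
have k'1 : k' < 1 by rewrite ltr_pdivrMr// mul1r -[ltRHS]/(1 + 1) ltrD2r.
have k'0 : 0 <= k' by rewrite ltW// (lt_trans kappa_gt0).
pose a n := intL (restr (~` S) (iter n P phi)).
have it0 n : 0 [<=] iter n P phi by exact: Markov_ge0 (iter_Markov MP n) _ phi0.
have a0 n : 0 <= a n by apply/int_ge0/restr_ge0.
have step n : exists n', a (n' + n)%N <= k' * a n.
  have psi0 : 0 [<=] restr (~` S) (iter n P phi) by exact: restr_ge0.
  have [n' Hn'] := outside_contracts psi0 kk'; exists n'.
  rewrite /a iterD.
  have {1}-> : iter n P phi = restr (~` S) (iter n P phi) + restr S (iter n P phi).
    by rewrite restrC// subrK.
  rewrite (MarkovD (iter_Markov MP n')) restrD// intD -[leRHS]addr0 lerD//.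
  rewrite -[leRHS](_ : intL (restr (~` S) (restr S (iter n P phi))) = 0).
    by apply: (@outside_iter_le _ 0%N n') => //; exact: restr_ge0.
  by rewrite restrC// restrK// subrr int0.
have pow k : exists n, a n <= k' ^+ k * a 0%N.
  elim: k => [|k [n ih]]; first by exists 0%N; rewrite expr0 mul1r.
  have [n' Hn'] := step n; exists (n' + n)%N; rewrite (le_trans Hn')// exprS -mulrA.
  by rewrite ler_wpM2l.
apply/cvgrPdist_le => e e0.
have : k' ^+ k * a 0%N @[k --> \oo] --> (0 : R).
  rewrite -[X in _ --> X](mul0r (a 0%N)); apply: cvgMr_tmp.
  by apply: cvg_expr; rewrite ger0_norm.
move=> /cvgrPdist_le/(_ e e0)[K _ /(_ K (leqnn K))]; rewrite sub0r normrN => Ke.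
have [N HN] := pow K; exists N => // n Nn; rewrite /= sub0r normrN ger0_norm ?a0//.
apply: le_trans (outside_iter_le Nn phi0) _.
by rewrite (le_trans HN)// (le_trans (ler_norm _) Ke).
Qed.

(** With S the support of the mean, g n = P^{n*} 1_S increases because S is
    absorbing, and the integral of 1 - g n is the mass of P^n 1 outside S. *)
Lemma family_maximal_support : maximal_support P (family_mean h).
Proof.
pose g n := iter n (adjoint P) (indic_class m S).
have gE n f : pairing f (g n) = intL (restr S (iter n P f)).
  by rewrite -iter_adjointP// pairing_indic.
have it0 n f : 0 [<=] f -> 0 [<=] iter n P f by exact: Markov_ge0 (iter_Markov MP n) f.
have g01 : {ae m, forall x n, 0 <= g n x <= 1}.
  apply: ae_foralln => n; apply: pairing_unit_interval => f f0; rewrite gE.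
  rewrite -(Markov_int (iter_Markov MP n) f) int_ge0/=; last exact/restr_ge0/it0.
  exact/le_int/restr_le/it0.
have gS : {ae m, forall x n, g n x <= g n.+1 x}.
  apply: ae_foralln => n; apply: pairing_le => f f0; rewrite !gE iterS.
  exact/abS/it0.
pose w n := mulL (oneL m) (g n).
have wE : {ae m, forall x n, w n x = g n x}.
  apply: ae_foralln => n.
  by apply: filterS2 (mulLE (oneL m) (g n)) (oneLE m) => x -> ->; rewrite mul1r.
have w1 : w n @[n --> \oo] --> oneL m.
  apply/subr_cvg0/norm_cvg0P.
  have -> : (fun n => `|w n - oneL m|) =
      (fun n => intL (restr (~` S) (iter n P (oneL m)))).
    apply/funext => n; rewrite distrC normL_ge0; last first.
      apply/subL_ge0; apply: filterS3 g01 wE (oneLE m) => x g01 -> ->.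
      by case/andP: (g01 n).
    rewrite intB -pairing_mulL gE restrC// intB.
    by rewrite (Markov_int (iter_Markov MP n)).
  exact: outside_cvg0 (oneL_ge0 m).
(* The upper limit is measurable whether or not the sequence converges. *)
pose V x := fine (limn_esup (fun n => (w n x)%:E)).
have mV : measurable_fun setT V.
  apply: measurableT_comp => //; apply: measurable_fun_limn_esup => n.
  exact/measurable_EFinP/L1_measurable.
have wV : {ae m, forall x, w n x @[n --> \oo] --> V x}.
  apply: filterS3 g01 wE gS => x g01 wx gS.
  have cw : cvgn (fun n => w n x).
    apply: nondecreasing_is_cvgn.
      by apply/nondecreasing_seqP => n; rewrite !wx.
    by exists 1 => _ [n _ <-]; rewrite wx; case/andP: (g01 n).
  have /cvg_ex[l wl] := cw.
  have /cvg_limn_einf_sup[_ VE] : (w n x)%:E @[n --> \oo] --> l%:E.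
    by apply: (@cvg_comp _ _ _ _ EFin _ (nbhs l)).
  by rewrite /V VE.
have [iV wV'] := @L1_dominated _ _ _ m w V (cst 1%E) mV wV
  (finite_measure_integrable_cst m 1 measurableT) ltac:(
    by apply: filterS2 g01 wE => x g01 wx n; rewrite wx lee_fin ger0_norm;
       case/andP: (g01 n)).
have V1 : toL1 m V = oneL m by exact: (cvg_unique _ wV' w1).
have VE := toL1E iV; rewrite V1 in VE.
apply: filterS3 (filterI wV wE) VE (oneLE m) => x [wx wgx] oV o1.
rewrite -[X in _ --> X]o1 oV.
have <- : (fun n => w n x) = (fun n => g n x) by apply/funext => n; rewrite wgx.
exact: wx.
Qed.

End maximal_support.

Lemma cesaro_small_FED : FED P.
Proof.
have [r [h [r0 hF hmax]]] := maximal_family_exists.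
exists r, h; split => //.
- by move=> i; split; [exact: hF.1|exact: maximal_ergodic hmax i].
- by move=> i j ij; apply/disjL_supp/hF.2.
- exact: family_maximal_support hF hmax.
Qed.

End small_means.

(** * Convergence of the Cesaro means to a compact set *)

Section compact_attractor.
Context d (T : measurableType d) (R : realType) (m : probability T R).
Variables (P : L1 m -> L1 m) (MP : Markov P).
Implicit Types (f g h phi : L1 m).

(** The coefficients range over the cube rather than the simplex, so that the
    invariant functions of integral at most 1 belong to it without being
    normalized. *)
Definition cube_span r (h : 'I_r -> L1 m) : set (L1 m) :=
  [set \sum_(i < r) a ord0 i *: h i | a in
    [set a : 'rV[R]_r | forall i, `[0 : R, 1]%classic (a ord0 i)]].

Lemma cube_span_compact r (h : 'I_r -> L1 m) : compact (cube_span h).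
Proof.
apply: continuous_compact; last first.
  exact: (@rV_compact R r (fun=> `[0, 1]%classic) (fun=> @segment_compact R 0 1)).
apply: continuous_subspaceT; elim: (index_enum _) => [|i s ih].
  rewrite (_ : (fun _ => _) = cst 0); first exact: cst_continuous.
  by apply/funext => a; rewrite big_nil.
rewrite (_ : (fun _ => _) = (fun a : 'rV[R]_r => a ord0 i *: h i +
    \sum_(j <- s) a ord0 j *: h j)).
  move=> a; apply: (@cvgD _ _ _ (nbhs a) _ _ _ _ _ _ (ih a)).
  exact: (@cvgZr_tmp _ _ _ (nbhs a) _ _ _ (h i) (@coord_continuous R 1 r ord0 i a)).
by apply/funext => a; rewrite big_cons.
Qed.

(** An invariant f of mass close to 1 lying essentially below a density F is
    close to F, hence to all Cesaro means of F, and these are asymptotic to those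
    of phi. *)
Lemma cesaro_near_invariant phi f kappa : 0 < kappa -> P f = f ->
  1 - kappa <= intL f -> below_means P phi f ->
  exists N, forall n, (N <= n)%N -> `|cesaro_mean P n.+1 phi - f| <= 4 * kappa.
Proof.
move=> k0 Pf fk /(_ kappa k0)[F [dF cF _ fF]].
have FE : `|F - f| <= 3 * kappa.
  rewrite distrC norm_posL intB; have /densitiesP[_ ->] := dF.
  move: fF fk; lra.
move/cvgrPdist_le : cF => /(_ kappa k0)[N _ HN]; exists N => n /HN.
rewrite sub0r normrN distrC => cE.
rewrite -(subrK (cesaro_mean P n.+1 F) (cesaro_mean P n.+1 phi)) -addrA.
rewrite (le_trans (ler_normD _ _))// [leRHS](_ : _ = kappa + 3 * kappa); last by ring.
rewrite lerD// -[X in _ - X](cesaro_fix n Pf) -(MarkovB (cesaro_Markov MP n)).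
exact: le_trans (Markov_norm (cesaro_Markov MP n) _) FE.
Qed.

Lemma ereal_inf_cvg0 (u : nat -> L1 m) (F : set (L1 m)) :
  (forall e, 0 < e -> exists f, F f /\
     exists N, forall n, (N <= n)%N -> `|u n - f| <= e) ->
  ereal_inf [set (`|u n - psi|)%:E | psi in F] @[n --> \oo] --> 0%E.
Proof.
move=> uF; have inf0 n : (0 <= ereal_inf [set (`|u n - psi|)%:E | psi in F])%E.
  by apply: le_ereal_inf_tmp => _ [psi _ <-]; rewrite lee_fin.
have infe e : 0 < e -> exists N, forall n, (N <= n)%N ->
    (ereal_inf [set (`|u n - psi|)%:E | psi in F] <= e%:E)%E.
  move=> e0; have [f [Ff [N HN]]] := uF e e0; exists N => n Nn.
  apply: le_trans (_ : (`|u n - f|%:E <= _)%E); last by rewrite lee_fin HN.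
  by apply: ereal_inf_lbound; exists f.
have fin n e : (ereal_inf [set (`|u n - psi|)%:E | psi in F] <= e%:E)%E ->
    ereal_inf [set (`|u n - psi|)%:E | psi in F] \is a fin_num.
  by move=> le; rewrite ge0_fin_numE// (le_lt_trans le)// ltry.
apply/fine_cvgP; split.
  by have [N HN] := infe 1 ltr01; exists N => // n /= /HN /fin.
apply/cvgrPdist_le => e e0; have [N HN] := infe e e0; exists N => // n /= Nn.
rewrite sub0r normrN ger0_norm ?fine_ge0// -lee_fin fineK; first exact: HN.
exact: fin (HN n Nn).
Qed.

Lemma constrictive_mean_constrictive :
  asymptotically_constrictive P -> mean_constrictive P.
Proof.
(* Any constant below 1 serves to fix the family of ergodic densities. *)
move=> AC; have [|delta0 d0 small0] := @constrictive_small _ _ _ _ _ MP AC 2^-1.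
  by rewrite invr_gt0.
have half1 : 2^-1 < 1 :> R by rewrite invf_lt1// ltr1n.
have [r [h [_ hF hmax]]] := maximal_family_exists MP half1 d0 small0.
exists (cube_span h); first exact: cube_span_compact.
move=> phi dphi; apply: ereal_inf_cvg0 => e e0.
have k0 : 0 < e / 4 by rewrite divr_gt0.
have [delta dl0 small] := constrictive_small MP AC k0.
have [f [f0 Pf fk bf]] := invariant_below MP dl0 small dphi.
exists f; split.
  exists (\row_i intL (restr (supp (h i)) f)).
    move=> i; rewrite /= mxE in_itv/=; have mS := measurable_supp (h i).
    rewrite int_ge0/=; last exact: restr_ge0.
    exact: le_trans (le_int (restr_le mS f0)) (below_means_int bf).
  rewrite [RHS](invariant_combination MP hF hmax f0 Pf).
  by apply: eq_bigr => i _; rewrite mxE.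
have [N HN] := cesaro_near_invariant k0 Pf fk bf.
(* The lemmas above speak of the means of index n.+1, the one of index 0 being
   the function 0. *)
exists N.+1 => -[//|n] Nn; apply: le_trans (HN n Nn) _.
by rewrite mulrC divfK ?pnatr_eq0.
Qed.

End compact_attractor.

Theorem theorem4p8 (d : measure_display) (T : measurableType d) (R : realType)
    (m : probability T R) (P : L1 m -> L1 m) :
  Markov P -> (AMC2 P -> FED P) /\ (asymptotically_constrictive P -> mean_constrictive P).
Proof.
move=> MP; split; last exact: constrictive_mean_constrictive.
move=> /AMC2_small[kappa [delta [kappa1 delta0 small]]].
exact: cesaro_small_FED small.
Qed.
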